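(* Let $k\geq 2$, $t\geq 1$ and $n\geq\max\{6k+6t-1,\ \frac32(k+t-1)^2+\frac32k+\frac32t+\frac12\}$ be integers, let $G^*=K_t\vee(K_{n-k-2t+1}\cup(k+t-1)K_1)$, and let $G$ be a $t$-connected graph of order $n$. If $q(G)\geq q(G^* )$, then $G$ has a spanning $k$-ended-tree unless $G\cong G^*$.
   Context: All graphs are finite, simple and undirected. $q(\cdot)$ is the largest eigenvalue of the signless Laplacian $Q=D+A$ (degree diagonal matrix plus adjacency matrix). A graph is $t$-connected if it has more than $t$ vertices and remains connected whenever fewer than $t$ vertices are removed. $K_m$ is the complete graph on $m$ vertices, $mK_1$ is $m$ isolated vertices, $\cup$ denotes disjoint union and $\vee$ denotes join. A $k$-ended-tree is a tree with at most $k$ leaves; a spanning $k$-ended-tree of $G$ is a spanning tree of $G$ with at most $k$ leaves. *)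

(* Defs.v *)
From mathcomp Require Import all_boot all_order all_algebra.
From mathcomp Require Import classical_sets reals.

Set Implicit Arguments.
Unset Strict Implicit.
Unset Printing Implicit Defensive.

Import GRing.Theory Num.Theory.

Record sgraph (V : finType) := SGraph {
  adj :> rel V;
  adj_sym : symmetric adj;
  adj_irrefl : irreflexive adj }.

Definition giso (V W : finType) (G : sgraph V) (H : sgraph W) : Prop :=
  exists2 f : V -> W, bijective f & forall x y, H (f x) (f y) = G x y.

Section Constructions.
Variables V W : finType.

Lemma complete_sym : symmetric (fun x y : V => x != y).
Proof. by move=> x y; rewrite eq_sym. Qed.
Lemma complete_irrefl : irreflexive (fun x y : V => x != y).
Proof. by move=> x; rewrite eqxx. Qed.
Definition complete_graph := SGraph complete_sym complete_irrefl.

Definition edgeless_graph : sgraph V :=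
  @SGraph V (fun _ _ => false) (fun _ _ => erefl) (fun _ => erefl).

Variables (G : sgraph V) (H : sgraph W).

Definition union_adj (u v : V + W) : bool :=
  match u, v with
  | inl x, inl y => G x y
  | inr x, inr y => H x y
  | _, _ => false
  end.
Lemma union_sym : symmetric union_adj.
Proof. by move=> [x|x] [y|y] //=; rewrite adj_sym. Qed.
Lemma union_irrefl : irreflexive union_adj.
Proof. by move=> [x|x] /=; rewrite adj_irrefl. Qed.
Definition disjoint_union := SGraph union_sym union_irrefl.

Definition join_adj (u v : V + W) : bool :=
  match u, v with
  | inl x, inl y => G x y
  | inr x, inr y => H x y
  | _, _ => true
  end.
Lemma join_sym : symmetric join_adj.
Proof. by move=> [x|x] [y|y] //=; rewrite adj_sym. Qed.
Lemma join_irrefl : irreflexive join_adj.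
Proof. by move=> [x|x] /=; rewrite adj_irrefl. Qed.
Definition join := SGraph join_sym join_irrefl.

Variable A : {set V}.

Definition induced_adj (x y : {x : V | x \in A}) : bool := G (val x) (val y).
Lemma induced_sym : symmetric induced_adj.
Proof. by move=> x y; apply: adj_sym. Qed.
Lemma induced_irrefl : irreflexive induced_adj.
Proof. by move=> x; apply: adj_irrefl. Qed.
Definition induced := SGraph induced_sym induced_irrefl.

End Constructions.

Section Notions.
Variables (V : finType) (G : sgraph V).

Definition degree (x : V) : nat := #|[set y | G x y]|.

Definition connected : Prop := (0 < #|V|)%N /\ forall x y, connect G x y.

(* A cycle needs at least three vertices: [:: x; y] with x adjacent to y
   also satisfies ucycle. *)
Definition acyclic : Prop := forall c : seq V, (2 < size c)%N -> ~ ucycle G c.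

Definition is_tree : Prop := connected /\ acyclic.

Definition leaves : {set V} := [set x | degree x == 1%N].

End Notions.

Definition t_connected (t : nat) (V : finType) (G : sgraph V) : Prop :=
  (t < #|V|)%N /\
  forall S : {set V}, (#|S| < t)%N -> connected (induced G (~: S)).

Definition has_spanning_ended_tree (k : nat) (V : finType) (G : sgraph V)
    : Prop :=
  exists T : sgraph V, [/\ subrel T G, is_tree T & (#|leaves T| <= k)%N].

Section SignlessLaplacian.
Local Open Scope ring_scope.
Local Open Scope classical_set_scope.
Variables (R : realType) (V : finType) (G : sgraph V).

Definition degree_mx : 'M[R]_#|V| :=
  diag_mx (\row_i (degree G (enum_val i))%:R).

Definition adjacency_mx : 'M[R]_#|V| :=
  \matrix_(i, j) (G (enum_val i) (enum_val j))%:R.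

Definition signless_laplacian : 'M[R]_#|V| := degree_mx + adjacency_mx.

(* The matrix is real symmetric, so for nonempty V its set of real eigenvalues
   is finite and nonempty, and the supremum is the largest eigenvalue. *)
Definition signless_radius : R :=
  sup [set a : R | eigenvalue signless_laplacian a].

End SignlessLaplacian.

(* K_t \/ (K_(n-k-2t+1) u (k+t-1) K_1); the truncated subtractions are exact
   when k + 2t <= n and 1 <= k + t. *)
Definition extremal_graph (n k t : nat) :
    sgraph ('I_t + ('I_(n - k - 2 * t + 1) + 'I_(k + t - 1))%type)%type :=
  join (complete_graph 'I_t)
       (disjoint_union (complete_graph 'I_(n - k - 2 * t + 1))
                       (edgeless_graph 'I_(k + t - 1))).

(* Main.v *)
Require Import Defs.
From mathcomp Require Import all_boot all_order all_algebra.
From mathcomp Require Import zify.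

(** Put s = k + t - 1 and n = #|V|.

    If G has no spanning k-ended-tree, neither has its Ore-type closure H, in
    which non-adjacent vertices have degree sum at most n - 2.  The eigenvalue
    hypothesis and q(G) <= 2e(G)/(n-1) + n - 2 leave G fewer than s(n-1) non-edges,
    which forces H to contain a clique C missing at most s vertices.

    Take a spanning tree of H with as few leaves as possible, m > k of them.
    Its leaves are pairwise non-adjacent.  If it is rooted at a leaf r and w is
    a neighbour of r with parent p(w) <> r, then p(w) has degree 2, and hanging
    w from r gives another minimal tree, whose leaves are those of the old one
    with r replaced by p(w).  Hence, for a second leaf l, the sets p(N(r)) - r,
    N(l) and the set of leaves are disjoint, so deg r + deg l + m <= n + 1.
    Some minimal tree has a leaf in C; there all inequalities become equalities,
    and the vertices outside C turn out to share one neighbourhood, of size t: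
    H is the extremal graph.

    Finally, a positive eigenvector of the extremal graph, obtained from a root
    of the cubic of its quotient matrix, shows that a connected proper spanning
    subgraph has strictly smaller signless Laplacian radius, so G = H. *)

Set Implicit Arguments.
Unset Strict Implicit.
Unset Printing Implicit Defensive.
Import GRing.Theory Num.Theory.

(** * Spanning trees as parent maps: reattaching a subtree and changing the root *)

Section RootedTrees.
Variable V : finType.
Implicit Types (p : V -> V) (r x y z : V) (e : rel V).

(* A spanning tree is encoded by the map sending each vertex to its parent; the
   root is its own parent. *)
Definition rooted p r := p r = r /\ forall x, fconnect p x r.

Definition reattach p x b := fun y => if y == x then b else p y.

Definition tdeg p r x : nat := #|[set y | (y != r) && (p y == x)]| + (x != r).

(** With at least two vertices [<= 1] means degree one, by [tdeg_gt0]; the root of a one-vertex tree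
    is counted as a leaf. *)
Definition tleaves p r := [set x | tdeg p r x <= 1].

Definition tree_in e p r := rooted p r /\ forall x, x != r -> e x (p x).

Definition spans e k := exists p r, tree_in e p r /\ #|tleaves p r| <= k.

Lemma fconnect_step p x y : fconnect p x y = (x == y) || fconnect p (p x) y.
Proof.
apply/idP/idP => [/iter_findex | /orP[/eqP->|h]].
- case: (findex p x y) => [/= ->|n]; first by rewrite eqxx.
  by rewrite iterSr => <-; rewrite fconnect_iter orbT.
- exact: connect0.
- exact: connect_trans (fconnect1 p x) h.
Qed.

Lemma rooted_ind (P : V -> Prop) p r : rooted p r -> P r ->
  (forall x, x != r -> P (p x) -> P x) -> forall x, P x.
Proof.
move=> [_ hc] Pr IH x; move: (iter_findex (hc x)).
move: (findex p x r) => n; elim: n x => [x /= -> //|n IHn x]; rewrite iterSr => h.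
by have [->//|xr] := eqVneq x r; apply: IH => //; apply: IHn.
Qed.

Lemma rooted_depth p r : rooted p r ->
  exists h : V -> nat, forall x, x != r -> h (p x) < h x.
Proof.
move=> [_ hc].
have ex x : exists n, iter n p x == r.
  by exists (findex p x r); apply/eqP/iter_findex.
exists (fun x => ex_minn (ex x)) => x xr.
case: (ex_minnP (ex x)) => [[|n]] /=; first by rewrite (negPf xr).
by rewrite -iterS iterSr => h _; case: ex_minnP => m _ /(_ _ h).
Qed.

Lemma fconnect_root p r x : p r = r -> fconnect p r x = (x == r).
Proof.
move=> pr; apply/idP/eqP => [/iter_findex <-|->]; last exact: connect0.
by elim: findex => //= n ->.
Qed.

Lemma rooted_parent_neq p r x : rooted p r -> x != r -> p x != x.
Proof.
move=> rp xr; have [h /(_ _ xr)] := rooted_depth rp.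
by apply: contraTneq => ->; rewrite ltnn.
Qed.

(** Depth never increases along an orbit of [p] and drops strictly from [x] to [p x], while [x] is
    at most as deep as its descendant [y]. *)
Lemma rooted_anc p r x y : rooted p r -> x != r -> fconnect p y x ->
  ~~ fconnect p (p x) y.
Proof.
move=> rp xr yx; have [h hh] := rooted_depth rp.
have mono z w : fconnect p z w -> h w <= h z.
  move/iter_findex; move: (findex p z w) => n; elim: n w => [w <- //|n IH w /= <-].
  apply: leq_trans (IH _ erefl); set a := iter _ _ _.
  by have [->|/hh/ltnW//] := eqVneq a r; rewrite rp.1.
apply/negP => /mono; have := mono _ _ yx; have := hh _ xr; lia.
Qed.

Lemma reattach_ndesc p x b z : ~~ fconnect p z x ->
  forall y, fconnect (reattach p x b) z y = fconnect p z y.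
Proof.
move=> nz y; have it n : iter n (reattach p x b) z = iter n p z.
  elim: n => //= n ->; rewrite /reattach; case: eqP => // h.
  by rewrite -h fconnect_iter in nz.
apply/idP/idP => /iter_findex <-; first by rewrite it fconnect_iter.
by rewrite -it fconnect_iter.
Qed.

Lemma rooted_reattach p r x b : rooted p r -> x != r -> ~~ fconnect p b x ->
  rooted (reattach p x b) r.
Proof.
move=> rp xr nb; have [pr hc] := rp.
have br : fconnect (reattach p x b) b r by rewrite reattach_ndesc.
split; first by rewrite /reattach eq_sym (negPf xr).
apply: (rooted_ind rp); first exact: connect0.
move=> y yr IH; rewrite fconnect_step {2}/reattach; apply/orP; right; case: (y =P x) => _.
  exact: br.
exact: IH.
Qed.

Lemma tdeg_sum p r x : tdeg p r x = \sum_(y | y != r) (p y == x) + (x != r).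
Proof.
by rewrite /tdeg -sum1dep_card big_mkcondr; congr (_ + _); apply: eq_bigr => y _; case: eqP.
Qed.

(** One unit of degree moves from [p x] to [b]. Adding the corrections on both sides avoids
    truncated subtraction and covers [b = p x]. *)
Lemma tdeg_reattach p r x b y : x != r ->
  tdeg (reattach p x b) r y + (y == p x) = tdeg p r y + (y == b).
Proof.
move=> xr; rewrite !tdeg_sum (bigD1 x) //= [in RHS](bigD1 x) //=.
rewrite {1}/reattach eqxx (eq_sym b) (eq_sym (p x)).
rewrite (eq_bigr (fun z => (p z == y) : nat)); last first.
  by move=> z /andP[_ /negPf zx]; rewrite /reattach zx.
lia.
Qed.

Lemma tdeg_gt0 p r x : rooted p r -> 1 < #|V| -> 0 < tdeg p r x.
Proof.
move=> rp V2; rewrite /tdeg; case: eqVneq => [->|]; last by rewrite addn1.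
rewrite addn0; have [z zr] : exists z, z != r.
  apply/existsP; rewrite -negb_forall; apply: contraTN V2 => /forallP h.
  by rewrite -leqNgt; apply/fintype_le1P => a b; rewrite (eqP (h a)) (eqP (h b)).
suff [y yr py] : exists2 y, y != r & p y = r.
  by apply/card_gt0P; exists y; rewrite inE yr py eqxx.
move: z zr; apply: (rooted_ind rp) => [|z zr IH _]; first by rewrite eqxx.
by have [e|/IH//] := eqVneq (p z) r; exists z.
Qed.

Lemma tdeg_child p r x y : y != r -> p y = x -> (x != r) < tdeg p r x.
Proof.
move=> yr e; rewrite /tdeg -[X in X < _]add0n ltn_add2r.
by apply/card_gt0P; exists y; rewrite inE yr e eqxx.
Qed.

Lemma tdeg_child2 p r x y z : y != r -> z != r -> y != z -> p y = x -> p z = x ->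
  1 + (x != r) < tdeg p r x.
Proof.
move=> yr zr yz py pz; rewrite /tdeg ltn_add2r.
by apply/card_gt1P; exists y, z; rewrite !inE yr zr py pz eqxx.
Qed.

Definition reroot p r c := reattach (reattach p r c) c c.

Lemma rerootE p r c x :
  reroot p r c x = if x == c then c else if x == r then c else p x.
Proof. by []. Qed.

Lemma rooted_reroot p r c : rooted p r -> c != r -> rooted (reroot p r c) c.
Proof.
move=> rp cr; split; first by rewrite rerootE eqxx.
apply: (rooted_ind rp) => [|x xr IH]; rewrite fconnect_step rerootE.
  by rewrite eq_sym (negPf cr) eqxx connect0.
by rewrite (negPf xr); case: eqP => //= _.
Qed.

Lemma tdeg_reroot p r c x : c != r -> p c = r ->
  tdeg (reroot p r c) c x = tdeg p r x.
Proof.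
move=> cr pc; rewrite !tdeg_sum (bigD1 r) 1?eq_sym //= [in RHS](bigD1 c) //=.
rewrite rerootE eqxx [r == c]eq_sym (negPf cr) pc.
rewrite (eq_bigl (fun y => (y != r) && (y != c))) => [|y]; last by rewrite andbC.
rewrite (eq_bigr (fun z => (p z == x) : nat)); last first.
  by move=> z /andP[/negPf zr /negPf zc]; rewrite rerootE zr zc.
move: (\sum_(_ | _) _) => S; rewrite ?[c == x]eq_sym ?[r == x]eq_sym.
by case: (x == c); case: (x == r); lia.
Qed.

Lemma tree_reroot e p r x : symmetric e -> tree_in e p r ->
  exists2 p', tree_in e p' x & forall y, tdeg p' x y = tdeg p r y.
Proof.
move=> es te; have [rp he] := te.
(* The root moves one edge at a time down the path to [x]. By the third clause only [x] and its
   ancestors have changed pointers, so the next vertex on the path still points to its old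
   parent. *)
suff [p' [t' d' _]] : exists p', [/\ tree_in e p' x,
    forall y, tdeg p' x y = tdeg p r y &
    forall y, ~~ fconnect p x y -> p' y = p y] by exists p'.
move: x; apply: (rooted_ind rp); first by exists p.
move=> x xr [p' [[rp' he'] hd hs]].
have xc : x != p x by rewrite eq_sym (rooted_parent_neq rp).
have p'x : p' x = p x by apply/hs/(rooted_anc rp xr)/connect0.
exists (reroot p' (p x) x); split; last first.
- move=> y; rewrite fconnect_step negb_or eq_sym rerootE => /andP[/negPf-> ny].
  by case: eqP => [yx|_]; [rewrite yx connect0 in ny | exact: hs].
- by move=> y; rewrite tdeg_reroot.
split; first exact: rooted_reroot.
move=> y yx; rewrite rerootE (negPf yx); case: eqP => [->|/eqP]; last exact: he'.
by rewrite es; apply: he.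
Qed.
End RootedTrees.

(** * From parent maps to tree graphs *)

Section TreeGraph.
Variables (V : finType) (p : V -> V) (r : V).
Hypothesis rp : rooted p r.

Definition tree_adj : rel V := fun x y => (x != y) && ((p x == y) || (p y == x)).

Lemma tree_adj_sym : symmetric tree_adj.
Proof. by move=> x y; rewrite /tree_adj eq_sym orbC. Qed.

Lemma tree_adj_irrefl : irreflexive tree_adj.
Proof. by move=> x; rewrite /tree_adj eqxx. Qed.

Definition tree_graph := SGraph tree_adj_sym tree_adj_irrefl.

Lemma tree_graph_connected : connected tree_graph.
Proof.
split; first by apply/card_gt0P; exists r.
suff h x : connect tree_graph x r.
  move=> x y; apply: connect_trans (h x) _.
  by rewrite (sym_connect_sym tree_adj_sym).
move: x; apply: (rooted_ind rp) => [|x xr]; first exact: connect0.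
apply: connect_trans; apply: connect1.
by rewrite /= /tree_adj eqxx eq_sym (rooted_parent_neq rp).
Qed.

(** On a cycle, a vertex of maximal depth would have its parent as both of its neighbours. *)
Lemma tree_graph_acyclic : acyclic tree_graph.
Proof.
have [h hh] := rooted_depth rp; move=> c c3 uc.
have [x0 x0c] : exists x, x \in c by case: c c3 {uc} => // x c _; exists x; rewrite inE eqxx.
have [x xc xmax] := @arg_maxnP V x0 (mem c) h x0c.
have nb y : y \in c -> tree_adj x y -> y = p x.
  move=> /xmax /= hy /andP[xy /orP[/eqP->//|/eqP yx]].
  have yr : y != r by apply: contraNneq xy => e; rewrite -yx e rp.1.
  by have := hh _ yr; rewrite yx ltnNge [_ <= _]hy.
have [i s rs] := rot_to xc.
have ms y : (y \in x :: s) = (y \in c) by rewrite -rs mem_rot.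
have : ucycle tree_graph (x :: s) by rewrite -rs /ucycle rot_cycle rot_uniq.
have : 2 < size (x :: s) by rewrite -rs size_rot.
case: s {rs} ms => [|y [|z s]] // ms _ /andP[/= /andP[xy]].
rewrite rcons_path => /and3P[_ _ lx] /and3P[_ + _].
have -> : y = p x by apply: nb xy; rewrite -ms !inE eqxx orbT.
suff <- : last z s = p x by rewrite mem_last.
apply: nb; last by rewrite tree_adj_sym.
by rewrite -ms !(in_cons x) (in_cons y) mem_last !orbT.
Qed.

Lemma tree_graph_degree x : degree tree_graph x = tdeg p r x.
Proof.
rewrite /tdeg /degree; have [->|xr] := eqVneq x r.
  rewrite addn0; apply: eq_card => y; rewrite !inE /= /tree_adj rp.1.
  by rewrite eq_sym; case: (y == r).
have np : p x \notin [set y | (y != r) && (p y == x)].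
  rewrite inE negb_and; apply/orP; right; apply/negP => /eqP h.
  by have := rooted_anc rp xr (connect0 _ x); have := fconnect1 p (p x); rewrite h => ->.
rewrite addnC.
have := cardsU1 (p x) [set y | (y != r) && (p y == x)]; rewrite np => <-.
apply: eq_card => y; rewrite !inE /= /tree_adj [p x == y]eq_sym.
case: (y =P p x) => [->|_] /=; first by rewrite eq_sym (rooted_parent_neq rp).
case: (p y =P x) => [e|_]; last by rewrite !andbF.
rewrite !andbT; apply/idP/idP; apply: contraNneq => e'.
  by rewrite -e e' rp.1.
by apply: contraT => yr; case/eqP: (rooted_parent_neq rp yr); rewrite e.
Qed.

End TreeGraph.

Lemma spans_ended_tree (V : finType) (H : sgraph V) k :
  spans H k -> has_spanning_ended_tree k H.
Proof.
move=> [p [r [[rp he] hl]]]; exists (tree_graph p); split.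
- move=> x y /andP[xy /orP[/eqP e|/eqP e]].
    by rewrite -e; apply: he; apply: contraNneq xy => xr; rewrite -e xr rp.1.
  by rewrite adj_sym -e; apply: he; apply: contraNneq xy => xr; rewrite -e xr rp.1.
- by split; [apply: tree_graph_connected rp | apply: tree_graph_acyclic rp].
apply: leq_trans hl; apply: subset_leq_card; apply/subsetP => x.
by rewrite !inE (tree_graph_degree rp) => /eqP->.
Qed.

(** * Existence of a spanning tree in a connected graph *)

Lemma fconnect_fixed (V : finType) (p : V -> V) r x y : p r = r ->
  fconnect p x y -> fconnect p x r -> fconnect p y r.
Proof.
move=> pr /iter_findex h /iter_findex h2; move: h h2.
set m := findex p x y; set n := findex p x r => h h2.
have [le|/ltnW le] := leqP m n; first by rewrite -h2 -(subnK le) iterD h fconnect_iter.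
rewrite -h -(subnK le) iterD h2 (_ : iter _ p r = r) ?connect0 //.
by elim: (m - n) => //= i ->.
Qed.

Lemma connected_tree (V : finType) (H : sgraph V) :
  connected H -> exists k, spans H k.
Proof.
move=> [/card_gt0P [r _] hc].
(* Vertices other than [r] may point to a neighbour or to themselves. A map with the most vertices
   reaching [r] is a tree: the outer end of an edge leaving that set could be attached as well. *)
pose good (p : {ffun V -> V}) := (p r == r) &&
  [forall x, (x != r) ==> H x (p x) || (p x == x)].
have g0 : good [ffun x => x].
  by rewrite /good ffunE eqxx; apply/forallP => x; rewrite ffunE eqxx orbT implybT.
have [p /andP[/eqP pr /forallP pe] pmax] :=
  @arg_maxnP _ [ffun x => x] good (fun p => #|[set x | fconnect p x r]|) g0.
suff all z0 : fconnect p z0 r.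
  exists #|V|, p, r; split; last exact: max_card.
  split => // x xr; have := pe x; rewrite xr => /orP[//|/eqP px].
  by have := all x; rewrite fconnect_root // eq_sym (negPf xr).
suff cl : closed H [pred x | fconnect p x r].
  by have /= := closed_connect cl (hc z0 r); rewrite !inE connect0.
apply: (intro_closed (sym_connect_sym (@adj_sym _ H))) => x y xy /= xr.
apply: contraT => nyr; move: xr; rewrite inE => xr.
have yr : y != r by apply: contraNneq nyr => ->; exact: connect0.
have to_r z : fconnect p z r -> ~~ fconnect p z y.
  by move=> zr; apply: contra nyr => zy; apply: fconnect_fixed zy zr.
pose p' := [ffun z => reattach p y x z].
have e' : p' =1 reattach p y x by move=> z; rewrite ffunE.
have ec a b : fconnect p' a b = fconnect (reattach p y x) a b by apply: eq_fconnect.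
have old z : fconnect p z r -> fconnect p' z r.
  by move=> zr; rewrite ec reattach_ndesc ?to_r.
have p'r : p' r = r by rewrite e' /reattach eq_sym (negPf yr).
have g' : good p'.
  rewrite /good p'r eqxx; apply/forallP => z; apply/implyP => zr.
  rewrite e' /reattach; case: (z =P y) => [->|zy]; first by rewrite adj_sym xy.
  by have := pe z; rewrite zr.
have /= := pmax _ g'; rewrite leqNgt => /negP; case; apply: proper_card.
apply/properP; split; first by apply/subsetP => z; rewrite !inE; apply: old.
exists y; rewrite inE // fconnect_step e' /reattach eqxx.
by rewrite old ?orbT.
Qed.

(** * The degree-sum closure for spanning trees with at most [k] leaves *)

Section Closure.
Variables (V : finType).

Lemma reattach_conn (p : V -> V) x b z y : fconnect (reattach p x b) z y ->
  fconnect p z y || fconnect (reattach p x b) b y.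
Proof.
move/iter_findex; move: (findex _ z y) => n; elim: n z => [z <-|n IH z].
  by rewrite connect0.
rewrite iterSr {2}/reattach; case: (z =P x) => [_ <-|_ /IH /orP[h|->]].
- by rewrite fconnect_iter orbT.
- by rewrite (connect_trans (fconnect1 p z) h).
by rewrite orbT.
Qed.

Lemma leq_tleaves (p p' : V -> V) r :
  (forall x, tdeg p' r x <= 1 -> tdeg p r x <= 1) -> #|tleaves p' r| <= #|tleaves p r|.
Proof. by move=> h; apply/subset_leq_card/subsetP => x; rewrite !inE; apply: h. Qed.

(* [p] is a tree of H + uv rooted at [u] and using the edge uv; the sets range over
   the component of the tree minus uv that contains [u].  Each exchange in the
   proof hangs [v] (and sometimes [w] from [u]) elsewhere in that component. *)
Lemma closure_side (H : sgraph V) k u v p :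
  rooted p u -> v != u -> p v = u -> (forall x, x != u -> x != v -> H x (p x)) ->
  #|tleaves p u| <= k -> ~ spans H k -> ~~ H u v ->
  #|[set w | H u w & ~~ fconnect p w v]| + #|[set w | H v w & ~~ fconnect p w v]|
    < #|[set w | ~~ fconnect p w v]|.
Proof.
move=> rp vu pv he hk hn nuv.
have pu := rp.1.
set A := [set w | H u w & _]; set B := [set w | H v w & _]; set T1 := [set w | _].
have uT : u \in T1 by rewrite inE fconnect_root.
have AT : A \subset T1 by apply/subsetP => w; rewrite !inE => /andP[].
have BT : B \subset T1 by apply/subsetP => w; rewrite !inE => /andP[].
have [->|[y yB]] := set_0Vmem B.
  rewrite cards0 addn0; apply: proper_card; apply/properP; split => //.
  by exists u; rewrite // inE adj_irrefl.
have V2 : 1 < #|V| by apply: leq_trans (max_card [set u; v]); rewrite cards2 eq_sym vu.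
have [hvy yT] : H v y /\ ~~ fconnect p y v by move: yB; rewrite inE => /andP.
have yu : y != u by apply: contraNneq nuv => <-; rewrite adj_sym.
(* Hanging [v] from a neighbour [z] on the side of [u] replaces uv by an edge of [H], so the
   resulting spanning tree must have more than [k] leaves. *)
have attach z p1 : rooted p1 u -> (forall x, x != u -> x != v -> H x (p1 x)) ->
    H v z -> ~~ fconnect p1 z v -> k < #|tleaves (reattach p1 v z) u|.
  move=> rp1 he1 vz nz; rewrite ltnNge; apply/negP => le; apply: hn.
  exists (reattach p1 v z), u; split => //; split; first exact: rooted_reattach.
  by move=> x xu; rewrite /reattach; case: eqP => [->//|/eqP]; apply: he1.
have degu : tdeg p u u <= 2.
  rewrite leqNgt; apply/negP => u3; have := attach y p rp he hvy yT.
  rewrite ltnNge (leq_trans _ hk) //; apply: leq_tleaves => x.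
  have := tdeg_reattach p y x vu; rewrite pv; have [->|_] := eqVneq x u; move: u3; clear; lia.
(* A leaf [z] adjacent to [v] would stop being a leaf once [v] hangs from it, with [u] as the only
   possible new leaf. *)
have Bdeg z : z \in B -> 1 < tdeg p u z.
  rewrite inE => /andP[vz zT]; rewrite ltnNge; apply/negP => z1.
  have := attach z p rp he vz zT; rewrite ltnNge => /negP; apply.
  have zL : z \in tleaves p u by rewrite inE.
  apply: leq_trans hk; rewrite (cardsD1 z (tleaves p u)) zL.
  apply: leq_trans (_ : #|u |: tleaves p u :\ z| <= _).
    apply/subset_leq_card/subsetP => x; rewrite !inE.
    have := tdeg_reattach p z x vu; have := tdeg_gt0 x rp V2; rewrite pv.
    have [//|xu] := eqVneq x u; have [->|xz] := eqVneq x z => /=; clear; lia.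
  by rewrite cardsU1 leq_add2r; case: (_ \notin _).
have Aprop w : w \in A -> [/\ H u w, ~~ fconnect p w v, w != u & w != v].
  rewrite inE => /andP[uw wT]; split=> //.
    by apply: contraTneq uw => ->; rewrite adj_irrefl.
  by apply: contraNneq wT => ->; exact: connect0.
have p1P w : w \in A -> [/\ rooted (reattach p w u) u,
    forall x, x != u -> x != v -> H x (reattach p w u x),
    forall z, ~~ fconnect p z v -> ~~ fconnect (reattach p w u) z v &
    reattach p w u v = u].
  move=> /Aprop[uw wT wu wv]; split.
  - by apply: rooted_reattach => //; rewrite fconnect_root.
  - move=> x xu xv; rewrite /reattach; case: eqP => [->|_]; last exact: he.
    by rewrite adj_sym.
  - move=> z zT; apply: contra zT => /reattach_conn /orP[//|].
    rewrite fconnect_root ?(negPf vu) // /reattach eq_sym (negPf wu).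
    exact: pu.
  - by rewrite /reattach eq_sym (negPf wv).
(* Otherwise hang [w] from [u] and [v] from [y]: [p w] keeps degree at least 2. *)
have Adeg w : w \in A -> p w != u -> tdeg p u (p w) <= 2.
  move=> wA pwu; have [uw wT wu wv] := Aprop w wA; have [r1 e1 c1 v1] := p1P w wA.
  rewrite leqNgt; apply/negP => d3; have := attach y _ r1 e1 hvy (c1 _ yT).
  rewrite ltnNge (leq_trans _ hk) //; apply: leq_tleaves => x.
  have := tdeg_reattach (reattach p w u) y x vu; rewrite v1.
  have := tdeg_reattach p u x wu; have [->|_] := eqVneq x (p w); move: d3; clear; lia.
(* Otherwise hang [w] from [u] and [v] from [p w]: no degree changes. *)
have AB w : w \in A -> p w \notin B.
  move=> wA; have [uw wT wu wv] := Aprop w wA; have [r1 e1 c1 v1] := p1P w wA.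
  rewrite inE; apply/andP => -[vpw pwT]; have := attach (p w) _ r1 e1 vpw (c1 _ pwT).
  rewrite ltnNge (leq_trans _ hk) //; apply: leq_tleaves => x.
  have := tdeg_reattach (reattach p w u) (p w) x vu; rewrite v1.
  have := tdeg_reattach p u x wu; clear; lia.
(* A common parent of two vertices of [A] has degree at least 3: its own parent counts if it is not
   [u], and the child [v] counts if it is. *)
have inj : {in A &, injective p}.
  move=> a b aA bA pab; apply/eqP; apply: contraT => ab.
  have [_ _ au av] := Aprop a aA; have [_ _ bu bv] := Aprop b bA.
  have [pau|pau] := eqVneq (p a) u; last first.
    have := tdeg_child2 au bu ab erefl (esym pab); have := Adeg _ aA pau.
    by rewrite pau; clear; lia.
  suff : 3 <= tdeg p u u by move: degu; clear; lia.
  have -> : 3 = #|v |: [set a; b]|.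
    by rewrite cardsU1 cards2 ab !inE ![v == _]eq_sym (negPf av) (negPf bv).
  rewrite /tdeg eqxx addn0; apply/subset_leq_card/subsetP => x.
  by rewrite !inE => /or3P[] /eqP->; rewrite ?vu ?au ?bu ?pv ?pau -?pab ?pau eqxx.
have [h hh] := rooted_depth rp.
(* A deepest vertex [l] of the component has no children, so it is not the parent of a vertex of
   [A], and as a leaf it is not in [B]. This makes the inequality strict. *)
have [l /andP[lu lT] lmax] : exists2 l, (l != u) && (l \in T1) &
    forall z, (z != u) && (z \in T1) -> h z <= h l.
  have y0 : (y != u) && (y \in T1) by rewrite yu inE.
  by have [l ? ?] := @arg_maxnP V y (fun z => (z != u) && (z \in T1)) h y0; exists l.
have lleaf z : z != u -> p z != l.
  move=> zu; apply: contraTneq (hh z zu) => pz; rewrite -leqNgt pz; apply: lmax.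
  rewrite zu inE fconnect_step pz negb_or; move: lT; rewrite inE => ->; rewrite andbT.
  by apply: contraNneq lu => zv; rewrite -pz zv pv.
have Tp w : w \in A -> p w \in T1.
  by case/Aprop => _ + _ _; rewrite fconnect_step negb_or inE => /andP[].
rewrite -(card_in_imset inj) -cardsUI (_ : _ :&: _ = set0); last first.
  apply/setP => z; rewrite in_set0 in_setI; apply/negbTE/andP => -[/imsetP[w wA ->]].
  exact/negP/AB.
rewrite cards0 addn0; apply: proper_card; apply/properP; split.
  rewrite subUset BT andbT; apply/subsetP => _ /imsetP[w /Tp pw ->] //.
exists l => //; rewrite inE negb_or; apply/andP; split.
  apply/imsetP => -[w wA lw]; have [_ _ wu _] := Aprop w wA.
  by have := lleaf w wu; rewrite lw eqxx.
apply/negP => /Bdeg; rewrite ltnNge /tdeg lu addn1 ltnS leqn0 cards_eq0.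
by move/negP; apply; apply/eqP/setP => z; rewrite !inE; apply/negbTE/andP => -[/lleaf/negPf->].
Qed.


Definition add_edge_adj (H : sgraph V) (u v : V) : rel V :=
  fun x y => H x y || [&& x != y, x \in [:: u; v] & y \in [:: u; v]].

Lemma add_edge_sym (H : sgraph V) u v : symmetric (add_edge_adj H u v).
Proof. by move=> x y; rewrite /add_edge_adj adj_sym eq_sym [(x \in _) && _]andbC. Qed.

Lemma add_edge_irrefl (H : sgraph V) u v : irreflexive (add_edge_adj H u v).
Proof. by move=> x; rewrite /add_edge_adj adj_irrefl eqxx. Qed.

Definition add_edge (H : sgraph V) u v :=
  SGraph (add_edge_sym H u v) (add_edge_irrefl H u v).

(** A tree of the larger graph with at most [k] leaves must use the edge uv. Each component left by
    its removal gives one instance of [closure_side]; the two strict inequalities account for the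
    2. *)
Lemma closure_degree (H : sgraph V) k u v : u != v -> ~~ H u v ->
  ~ spans H k -> spans (add_edge H u v) k -> degree H u + degree H v + 2 <= #|V|.
Proof.
move=> uv nuv hn [p0 [r [t0 hl0]]].
have [p [rp he] hd] := tree_reroot u (@adj_sym _ (add_edge H u v)) t0.
have hl : #|tleaves p u| <= k.
  apply: leq_trans hl0; apply/subset_leq_card/subsetP => x.
  by rewrite !inE hd.
have pu := rp.1; have vu : v != u by rewrite eq_sym.
have he' x : x != u -> x != v -> H x (p x).
  move=> xu xv; have /= := he x xu; rewrite /add_edge_adj !inE.
  by rewrite (negPf xu) (negPf xv) andbF orbF.
have pv : p v = u.
  apply/eqP; apply: contraT => pvu; case: hn; exists p, u; split => //; split => // x xu.
  have [xv|] := eqVneq x v; last exact: he'.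
  have /= := he x xu; rewrite xv /add_edge_adj !inE (negPf pvu) /= => /orP[//|].
  by rewrite eq_sym => /and3P[/negPf->].
pose p2 := reroot p u v.
have rp2 : rooted p2 v by apply: rooted_reroot.
have swap w : fconnect p2 w u = ~~ fconnect p w v.
  move: w; apply: (rooted_ind rp) => [|w wu IH].
    by rewrite connect0 fconnect_root // vu.
  rewrite fconnect_step (negPf wu) /p2 rerootE (negPf wu) [in RHS]fconnect_step.
  case: (w =P v) => [wv|_] /=; last exact: IH.
  by rewrite fconnect_root ?rerootE ?eqxx // eq_sym (negPf vu).
have s1 := closure_side rp vu pv he' hl hn nuv.
have := @closure_side H k v u p2 rp2 uv; rewrite {1}/p2 rerootE (negPf uv) eqxx.
move=> /(_ erefl); have -> : #|tleaves p2 v| = #|tleaves p u|.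
  by apply: eq_card => x; rewrite !inE tdeg_reroot.
have e2 x : x != v -> x != u -> H x (p2 x).
  by move=> xv xu; rewrite /p2 rerootE (negPf xu) (negPf xv); apply: he'.
move=> /(_ e2 hl hn); rewrite adj_sym => /(_ nuv).
have split_deg x : degree H x = #|[set w | H x w & ~~ fconnect p w v]|
    + #|[set w | H x w & ~~ fconnect p2 w u]|.
  rewrite /degree -(cardsID [set w | ~~ fconnect p w v]); congr (_ + _).
    by apply: eq_card => w; rewrite !inE.
  by apply: eq_card => w; rewrite !inE swap negbK andbC.
have <- : #|[set w | ~~ fconnect p w v]| + #|[set w | ~~ fconnect p2 w u]| = #|V|.
  rewrite -(cardsC [set w | ~~ fconnect p w v]); congr (_ + _).
  by apply: eq_card => w; rewrite !inE swap.
by move: s1; rewrite !split_deg; clear; lia.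
Qed.

(** Non-adjacent pairs of degree sum at least n - 1 are joined one after another. By
    [closure_degree] no tree with at most [k] leaves appears, and the number of non-edges drops. *)
Lemma closed_supergraph (G : sgraph V) k : ~ spans G k ->
  exists H : sgraph V, [/\ subrel G H, ~ spans H k &
    forall u v, u != v -> ~~ H u v -> degree H u + degree H v + 2 <= #|V|].
Proof.
have [m] := ubnP #|[set z : V * V | ~~ G z.1 z.2]|; elim: m G => // m IH G lm hn.
have [/existsP[u /existsP[v /and3P[uv nuv d]]]|no] :=
    boolP [exists u, exists v, [&& u != v, ~~ G u v & #|V| < degree G u + degree G v + 2]].
  have sub : subrel G (add_edge G u v) by move=> x y xy; rewrite /= /add_edge_adj xy.
  have [||H [GH hH dH]] := IH (add_edge G u v).
  - rewrite ltnS in lm; apply: leq_trans lm; apply: proper_card; apply/properP; split.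
      by apply/subsetP => z; rewrite !inE; apply: contra => /sub.
    by exists (u, v); rewrite !inE //= /add_edge_adj uv !inE !eqxx !orbT.
  - by move=> h; have := closure_degree uv nuv hn h; rewrite leqNgt d.
  by exists H; split => // x y /sub/GH.
exists G; split => // u v uv nuv; rewrite leqNgt; apply: contra no => d.
by apply/existsP; exists u; apply/existsP; exists v; rewrite uv nuv.
Qed.

End Closure.

(** * Exchanges in spanning trees with the fewest leaves *)

Section MinimalTrees.
Variable V : finType.
Implicit Type p : V -> V.

Lemma eq_on_orbit (p p' : V -> V) b : (forall z, fconnect p b z -> p' z = p z) ->
  fconnect p' b =1 fconnect p b.
Proof.
move=> h; have it n : iter n p' b = iter n p b.
  by elim: n => //= n ->; apply: h; rewrite fconnect_iter.
by move=> y; apply/idP/idP => /iter_findex <-; rewrite ?it ?fconnect_iter // -it fconnect_iter.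
Qed.

(* The tree edge from [x] to its parent is replaced by the edge ab, which reverses
   the parent pointers on the path from [a] to [x]. *)
Lemma tree_exchange (e : rel V) p r x a b : symmetric e -> tree_in e p r ->
  x != r -> fconnect p a x -> ~~ fconnect p b x -> e a b ->
  exists2 p', tree_in e p' r &
    forall y, tdeg p' r y + (y == x) + (y == p x) = tdeg p r y + (y == a) + (y == b).
Proof.
move=> es [rp he] xr ax nbx eab; have pr := rp.1.
(* Induction along the path from [a] to [x], the only place where pointers change. The edge
   condition leaves out [a], because [p a] hangs from [b] at first and is moved to [a]
   afterwards. *)
suff [p' [rp' p'a hd he' _]] : exists p', [/\ rooted p' r, p' a = b,
    forall y, tdeg p' r y + (y == x) + (y == p x) = tdeg p r y + (y == a) + (y == b),
    forall y, y != r -> y != a -> e y (p' y) &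
    forall y, ~~ fconnect p y x || ~~ fconnect p a y -> p' y = p y].
  exists p' => //; split => // y yr; have [->|] := eqVneq y a; last exact: he'.
  by rewrite p'a.
move: (iter_findex ax) => {eab}; move: (findex p a x) => n; elim: n a ax => [|n IH] a ax.
  move=> /= ->; exists (reattach p x b); split.
  - exact: rooted_reattach.
  - by rewrite /reattach eqxx.
  - by move=> y; have := tdeg_reattach p b y xr; clear; lia.
  - by move=> y yr /negPf yx; rewrite /reattach yx; apply: he.
  - move=> y h; rewrite /reattach; case: eqP => // yx; move: h; rewrite yx.
    by rewrite connect0.
rewrite iterSr => itn; have pax : fconnect p (p a) x by rewrite -itn fconnect_iter.
have [p1 [rp1 p1a hd1 he1 hu1]] := IH _ pax itn.
have ar : a != r by apply: contraTneq ax => ->; rewrite fconnect_root.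
have ap : p a != a := rooted_parent_neq rp ar.
have p1a' : p1 a = p a by rewrite hu1 // (rooted_anc rp ar (connect0 _ a)) orbT.
have par : p a != r.
  by apply: contraTneq pax => ->; rewrite fconnect_root.
have ob : fconnect p1 b =1 fconnect p b.
  apply: eq_on_orbit => z bz; rewrite hu1 //; apply/orP; left.
  by apply: contra nbx => zx; apply: connect_trans zx.
have nba : ~~ fconnect p1 b a.
  by rewrite ob; apply: contra nbx => ba; apply: connect_trans ax.
pose p1' := reattach p1 a b.
have rp1' : rooted p1' r by apply: rooted_reattach.
have nap : ~~ fconnect p1' a (p a).
  rewrite fconnect_step negb_or eq_sym ap {2}/p1' /reattach eqxx.
  rewrite reattach_ndesc // ob; apply: contra nbx => h; exact: connect_trans pax.
exists (reattach p1' (p a) a); split.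
- exact: rooted_reattach.
- by rewrite /reattach eq_sym (negPf ap) /p1' /reattach eqxx.
- move=> y; have := tdeg_reattach p1' a y par; have := tdeg_reattach p1 b y ar.
  have := hd1 y; rewrite -/p1' p1a' {3}/p1' /reattach (negPf ap) p1a -/(reattach _ _ _).
  clear; lia.
- move=> y yr ya; rewrite /reattach /p1' /reattach (negPf ya).
  have [->|] := eqVneq y (p a); first by rewrite es; apply: he.
  exact: he1.
- move=> y h; have [ya|ya] := eqVneq y a.
    by move: h; rewrite ya ax connect0.
  have [yp|yp] := eqVneq y (p a).
    by move: h; rewrite yp pax fconnect1.
  rewrite /reattach /p1' /reattach (negPf ya) (negPf yp); apply: hu1.
  by case/orP: h => [->//|h]; apply/orP; right; apply: contra h; apply: connect_trans (fconnect1 p a).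
Qed.

Section Minimal.
Variables (H : sgraph V) (q : nat).
Hypothesis q3 : 2 < q.
Hypothesis qmin : forall p r, tree_in H p r -> q <= #|tleaves p r|.

Definition min_tree p r (L : {set V}) := [/\ tree_in H p r, tleaves p r = L & #|L| = q].

Lemma min_tree_reroot p r L x : min_tree p r L -> exists p', min_tree p' x L.
Proof.
move=> [te eL cL]; have [p' te' hd] := tree_reroot x (@adj_sym _ H) te.
by exists p'; split => //; rewrite -eL; apply/setP => y; rewrite !inE hd.
Qed.

Lemma min_tree_card p r L : min_tree p r L -> 1 < #|V|.
Proof. by move=> [_ _ cL]; apply: leq_trans (max_card L); rewrite cL; apply: ltnW. Qed.

Lemma leaf_no_child p r L w z : min_tree p r L -> w \in L -> w != r -> z != r -> p z != w.
Proof.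
move=> [_ <- _]; rewrite inE => wL wr zr; apply: contraTneq wL => pz.
by rewrite -ltnNge; have := tdeg_child zr pz; rewrite wr.
Qed.

Lemma root_one_child p r L y z : min_tree p r L -> r \in L -> y != r -> z != r ->
  p y = r -> p z = r -> y = z.
Proof.
move=> [_ <- _]; rewrite inE => rL yr zr py pz; apply/eqP; apply: contraLR rL => yz.
by rewrite -ltnNge; have := tdeg_child2 yr zr yz py pz; rewrite eqxx.
Qed.

Lemma orbit_child p r w z : rooted p r -> fconnect p w z -> z != w ->
  exists d, [/\ d != r, p d = z & fconnect p w d].
Proof.
move=> rp; move: w; apply: (rooted_ind rp) => [|w wr IH].
  by rewrite fconnect_root ?rp.1 // => /eqP->; rewrite eqxx.
rewrite fconnect_step eq_sym => /orP[->//|h] zw.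
have [zpw|zpw] := eqVneq z (p w); first by exists w; rewrite connect0.
have [d [dr pd cd]] := IH h zpw; exists d; split => //.
exact: connect_trans (fconnect1 p w) cd.
Qed.

(** A third leaf exists, so the path from [w] to [r] misses a vertex. A missed vertex whose parent
    is on the path makes that parent branch, and [x] is the child on the path. *)
Lemma branch_on_path p r L w : min_tree p r L -> r \in L -> w \in L -> w != r ->
  exists x, [/\ x != r, fconnect p w x, p x != r & 2 < tdeg p r (p x)].
Proof.
move=> mt rL wL wr; have [[rp he] eL cL] := mt; have pr := rp.1.
have [y /and3P[yr wy nwy]] : exists y, [&& y != r, fconnect p w (p y) & ~~ fconnect p w y].
  apply/existsP; apply: contraT; rewrite negb_exists => /forallP no.
  have all y : fconnect p w y.
    move: y; apply: (rooted_ind rp) => [|y yr IH]; first exact: rp.2.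
    by have := no y; rewrite yr IH negbK.
  have : L \subset [set w; r].
    apply/subsetP => z zL; rewrite !inE; have [//|zr] := eqVneq z r; first by rewrite orbT.
    rewrite orbF; apply: contraT => zw; have [d [dr pd _]] := orbit_child rp (all z) zw.
    by have := leaf_no_child mt zL zr dr; rewrite pd eqxx.
  move/subset_leq_card; rewrite cL cards2; case: (_ != _); move: q3; clear; lia.
have pyw : p y != w by apply: leaf_no_child mt wL wr yr.
have [d [dr pd cd]] := orbit_child rp wy pyw.
have dy : d != y by apply: contraNneq nwy => <-.
have pyr : p y != r.
  by apply: contraNneq dy => e; apply/eqP; apply: (root_one_child mt rL); rewrite ?pd.
exists d; split; rewrite ?pd //.
by have := tdeg_child2 dr yr dy pd erefl; rewrite pyr.
Qed.

(** If two leaves were adjacent, joining them and deleting the edge below a branching vertex between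
    them would lose two leaves and create at most one. *)
Lemma leaves_independent p r L v w : min_tree p r L -> v \in L -> w \in L -> ~~ H v w.
Proof.
move=> mt0 vL wL; have [p' mt] := min_tree_reroot v mt0.
have [->|wv] := eqVneq w v; first by rewrite adj_irrefl.
have [x [xv wx pxv d3]] := branch_on_path mt vL wL wv.
have [te eL cL] := mt; have [rp he] := te; apply/negP => vw.
have nvx : ~~ fconnect p' v x by rewrite fconnect_root ?rp.1.
have [p2 te2 hd] : exists2 p2, tree_in H p2 v & forall y,
    tdeg p2 v y + (y == x) + (y == p' x) = tdeg p' v y + (y == w) + (y == v).
  by apply: tree_exchange => //; [apply: adj_sym | rewrite adj_sym].
have := qmin te2; rewrite leqNgt => /negP; apply.
have sub : tleaves p2 v \subset x |: (L :\ v :\ w).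
  have V2 := min_tree_card mt.
  have wv' : v != w by rewrite eq_sym.
  apply/subsetP => y; rewrite -eL !inE.
  have := hd y; have := tdeg_gt0 y rp V2; move: d3.
  have [//|yx] := eqVneq y x; have [->|ypx] := eqVneq y (p' x).
    by case: (_ == w); case: (_ == v) => /=; clear; lia.
  by case: (y =P w) => [->|_]; case: (_ =P v) => [_|_] /=; clear; lia.
apply: leq_ltn_trans (subset_leq_card sub) _.
apply: (@leq_ltn_trans (1 + #|L :\ v :\ w|)); first by rewrite cardsU1 leq_add2r; case: (_ \notin _).
move: cL; rewrite (cardsD1 v L) vL (cardsD1 w (L :\ v)) !inE wv wL; clear; lia.
Qed.

(** Once [w] hangs from [r], the root is no longer a leaf, so by minimality [p w] must become one;
    hence its old degree was 2. *)
Lemma leaf_swap p r L w : min_tree p r L -> r \in L -> H r w -> p w != r ->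
  [/\ tdeg p r (p w) = 2, p w \notin L & exists p', min_tree p' r (p w |: L :\ r)].
Proof.
move=> mt rL rw pwr; have [te eL cL] := mt; have [rp he] := te; have V2 := min_tree_card mt.
have wr : w != r by apply: contraTneq rw => ->; rewrite adj_irrefl.
have te' : tree_in H (reattach p w r) r.
  split; first by apply: rooted_reattach => //; rewrite fconnect_root ?rp.1.
  by move=> x xr; rewrite /reattach; case: eqP => [->|_]; [rewrite adj_sym | apply: he].
have d2 : 2 <= tdeg p r (p w).
  by have := tdeg_child wr (erefl (p w)); rewrite pwr.
have hd y := tdeg_reattach p r y wr.
have sub : tleaves (reattach p w r) r \subset p w |: L :\ r.
  apply/subsetP => y; rewrite -eL !inE; have := hd y; have := tdeg_gt0 y rp V2.
  have [//|ypw] := eqVneq y (p w).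
  by case: (y =P r) => _ /=; clear; lia.
have pwL : p w \notin L by rewrite -eL inE -ltnNge.
have cLr : #|L| = #|L :\ r|.+1 by rewrite (cardsD1 r L) rL.
have eL' : tleaves (reattach p w r) r = p w |: L :\ r.
  apply/eqP; rewrite eqEcard sub; apply: leq_trans (qmin te'); rewrite cardsU1 -cL cLr.
  by case: (_ \notin _).
split => //; last first.
  exists (reattach p w r); split => //.
  by rewrite cardsU1 !inE (negPf pwL) andbF -cL cLr.
have : p w \in tleaves (reattach p w r) r by rewrite eL' !inE eqxx.
rewrite inE; have := hd (p w); rewrite eqxx (negPf pwr); move: d2; clear; lia.
Qed.

Lemma parent_inj p r L : min_tree p r L -> r \in L -> {in [set w | H r w] &, injective p}.
Proof.
move=> mt rL a b; rewrite !inE => ra rb pab.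
have ar : a != r by apply: contraTneq ra => ->; rewrite adj_irrefl.
have br : b != r by apply: contraTneq rb => ->; rewrite adj_irrefl.
have [par|par] := eqVneq (p a) r.
  by apply: (root_one_child mt rL) => //; rewrite -pab.
have [d2 _ _] := leaf_swap mt rL ra par; apply/eqP; apply: contraT => ab.
by have := tdeg_child2 ar br ab erefl (esym pab); rewrite par d2.
Qed.

(** For a leaf [r], each of these vertices can replace [r] as a leaf of a minimal tree, by
    [leaf_swap]. *)
Definition nbr_parents p r := p @: [set w | H r w] :\ r.

Lemma card_nbr_parents p r L : min_tree p r L -> r \in L ->
  degree H r <= #|nbr_parents p r|.+1.
Proof.
move=> mt rL; rewrite /degree -(card_in_imset (parent_inj mt rL)) /nbr_parents.
by rewrite (cardsD1 r (p @: _)); case: (_ \in _) => //; rewrite leqnSn.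
Qed.

Lemma nbr_parents_nadj p r L v z : min_tree p r L -> r \in L -> v \in L -> v != r ->
  z \in nbr_parents p r -> ~~ H v z.
Proof.
move=> mt rL vL vr; rewrite !inE => /andP[+ /imsetP[w]]; rewrite inE => zr rw e; subst z.
have [_ _ [p' mt']] := leaf_swap mt rL rw zr.
by apply: leaves_independent mt' _ _; rewrite !inE ?eqxx // vL vr orbT.
Qed.

Lemma nbr_parents_nleaf p r L z : min_tree p r L -> r \in L ->
  z \in nbr_parents p r -> z \notin L.
Proof.
move=> mt rL; rewrite !inE => /andP[+ /imsetP[w]]; rewrite inE => zr rw e; subst z.
by have [] := leaf_swap mt rL rw zr.
Qed.

Lemma nbr_subset p r L v : min_tree p r L -> r \in L -> v \in L -> v != r ->
  [set w | H v w] \subset ~: (nbr_parents p r :|: L).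
Proof.
move=> mt rL vL vr; apply/subsetP => z; rewrite in_set in_setC in_setU negb_or => vz.
apply/andP; split; first by apply: contraL vz; apply: nbr_parents_nadj mt rL vL vr.
by apply: contraL vz => zL; apply: leaves_independent mt vL zL.
Qed.

Lemma card_parents_leaves p r L : min_tree p r L -> r \in L ->
  #|nbr_parents p r :|: L| = #|nbr_parents p r| + q.
Proof.
move=> mt rL; rewrite cardsU (_ : _ :&: _ = set0) ?cards0 ?subn0.
  by have [_ _ ->] := mt.
apply/setP => z; rewrite in_set0 in_setI; apply/negbTE/andP => -[/(nbr_parents_nleaf mt rL)/negP].
exact.
Qed.

End Minimal.
End MinimalTrees.

(** * Equality in the leaf count and the structure of the closure *)

Section ExtremalStructure.
Variables (V : finType) (H : sgraph V).

Lemma min_leaf_tree : connected H -> exists p r, tree_in H p r /\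
  forall p' r', tree_in H p' r' -> #|tleaves p r| <= #|tleaves p' r'|.
Proof.
move=> /connected_tree[k [p0 [r0 [t0 _]]]].
pose good (z : {ffun V -> V} * V) := [&& z.1 z.2 == z.2,
  [forall x, fconnect z.1 x z.2] & [forall x, (x != z.2) ==> H x (z.1 x)]].
have goodP z : good z <-> tree_in H z.1 z.2.
  split=> [/and3P[/eqP a /forallP b /forallP c]|[[a b] c]].
    by split=> // x xr; have := c x; rewrite xr.
  rewrite /good a eqxx /=; apply/andP; split; first exact/forallP.
  by apply/forallP => x; apply/implyP; apply: c.
have ff p r : tree_in H p r -> good (finfun p, r) /\ tleaves (finfun p) r = tleaves p r.
  move=> [[pr hc] he]; split.
    apply/goodP; split => /=; last by move=> x xr; rewrite ffunE; apply: he.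
    split; first by rewrite ffunE.
    by move=> x; rewrite (@eq_fconnect _ _ p) // => y; rewrite ffunE.
  apply/setP => x; rewrite !inE /tdeg; congr (_ + _ <= _).
  by apply: eq_card => y; rewrite !inE ffunE.
have [z /goodP gz zmin] := @arg_minnP _ _ good (fun z => #|tleaves z.1 z.2|) (ff _ _ t0).1.
exists z.1, z.2; split => // p' r' /ff [g' <-]; exact: zmin g'.
Qed.

Lemma extremal_structure k t (C : {set V}) : 1 < k -> 0 < t -> connected H ->
  {in C &, forall x y, x != y -> H x y} -> (forall x, t <= degree H x) ->
  ~ spans H k -> #|~: C| <= k + t - 1 ->
  exists Z : {set V}, [/\ #|Z| = t, Z \subset C, #|~: C| = k + t - 1 &
    forall x, x \notin C -> [set w | H x w] = Z].
Proof.
move=> k1 t0 cH clC dmin hn cX.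
have [p0 [r0 [te0 qmin]]] := min_leaf_tree cH.
set q := #|tleaves p0 r0| in qmin.
have kq : k < q by rewrite ltnNge; apply/negP => le; apply: hn; exists p0, r0.
have q3 : 2 < q by apply: leq_trans kq.
have indep := leaves_independent q3 qmin.
have mt0 : min_tree H q p0 r0 (tleaves p0 r0) by [].
have nCX : #|C| + #|~: C| = #|V| := cardsC C.
have clL p r L u v : min_tree H q p r L -> u \in L -> v \in L -> u \in C -> v \in C -> u = v.
  move=> mt uL vL uC vC; apply/eqP; apply: contraT => uv.
  by have := indep p r L u v mt uL vL; rewrite clC.
(* If a leaf set [L] misses [C], then [z |: (~: C :\: L)] has at most t - 1 elements, whereas the
   neighbours of the leaf [z] have at least t distinct parents. So some parent lies in [C], and a
   swap makes it a leaf. *)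
have stepA : exists p u L, [/\ min_tree H q p u L, u \in L & u \in C].
  have fromL p r L u : min_tree H q p r L -> u \in L -> u \in C ->
      exists p u L, [/\ min_tree H q p u L, u \in L & u \in C].
    by move=> /(min_tree_reroot u)[p' mt] uL uC; exists p', u, L.
  have [z zL] : exists z, z \in tleaves p0 r0 by apply/card_gt0P; apply: leq_trans q3.
  have [p mt] := min_tree_reroot z mt0; move: (tleaves p0 r0) zL mt {mt0} => L zL mt.
  have [/existsP[u /andP[uL uC]]|no] := boolP [exists u, (u \in L) && (u \in C)].
    exact: fromL mt uL uC.
  have LX : L \subset ~: C.
    by apply/subsetP => x xL; rewrite inE; move: no; rewrite negb_exists => /forallP/(_ x); rewrite xL.
  have : ~~ (p @: [set w | H z w] \subset z |: (~: C :\: L)).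
    apply/negP => /subset_leq_card; rewrite (card_in_imset (parent_inj q3 qmin mt zL)).
    have := dmin z; have := subset_leq_card LX; rewrite /degree cardsU1 cardsDS //; have [_ _ ->] := mt.
    by move: cX kq; case: (_ \notin _) => /=; clear; lia.
  case/subsetPn => x /imsetP[w]; rewrite inE => zw ->; rewrite !inE negb_or => /andP[pwz].
  have [_ pwL [p' mt']] := leaf_swap q3 qmin mt zL zw pwz.
  rewrite pwL /= negbK => pwC; apply: fromL mt' _ pwC.
  by rewrite !inE eqxx.
(* The bounds deg u >= #|C| - 1, deg v >= t, q > k and #|~: C| <= k + t - 1 turn deg u + deg v + q
   <= n + 1 into a chain of equalities. *)
have stepB p u L : min_tree H q p u L -> u \in L -> u \in C ->
    [/\ q = k.+1, #|~: C| = k + t - 1, forall w, H u w -> w \in C &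
     forall v, v \in L -> v != u -> [/\ v \notin C,
       [set w | H v w] = ~: (nbr_parents H p u :|: L) & degree H v = t]].
  move=> mt uL uC; have [_ _ cL] := mt.
  have CN : C :\ u \subset [set w | H u w].
    by apply/subsetP => x; rewrite !inE => /andP[xu xC]; apply: clC => //; rewrite eq_sym.
  have du := card_nbr_parents q3 qmin mt uL.
  have cC : #|C| = #|C :\ u|.+1 by rewrite (cardsD1 u C) uC.
  have cu := subset_leq_card CN.
  have main v : v \in L -> v != u -> [/\ q = k.+1, #|~: C| = k + t - 1,
      degree H u <= #|C :\ u|, degree H v = t & #|~: (nbr_parents H p u :|: L)| = t].
    move=> vL vu; have sv := subset_leq_card (nbr_subset q3 qmin mt uL vL vu).
    have := card_parents_leaves q3 qmin mt uL; have := cardsC (nbr_parents H p u :|: L).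
    have := dmin v; move: du cC cu sv nCX cX kq t0; rewrite /degree; clear.
    move: #|nbr_parents H p u :|: L| #|~: (nbr_parents H p u :|: L)|.
    by move=> a b *; split; lia.
  have [v0 v0L v0u] : exists2 v, v \in L & v != u.
    have /card_gt0P[v] : 0 < #|L :\ u|.
      by move: cL q3; rewrite (cardsD1 u L) uL; clear; lia.
    by rewrite !inE => /andP[vu vL]; exists v.
  have [hq hX hu _ _] := main _ v0L v0u; split=> //.
    move=> w uw; have /eqP e : C :\ u == [set w | H u w] by rewrite eqEcard CN.
    by have : w \in C :\ u; [rewrite e inE | rewrite !inE => /andP[]].
  move=> v vL vu; have [_ _ _ dv cP] := main v vL vu; split => //.
    by apply: contra vu => vC; apply/eqP; apply: clL mt vL uL vC uC.
  by apply/eqP; rewrite eqEcard (nbr_subset q3 qmin mt uL vL vu) cP -dv leqnn.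
(* The right-hand side of the equality in [stepB] does not depend on [v]. *)
have same L u : (exists p, min_tree H q p u L) -> u \in L -> u \in C ->
    {in L :\ u &, forall v v', [set w | H v w] = [set w | H v' w]}.
  move=> [p mt] uL uC v v'; rewrite !inE => /andP[vu vL] /andP[v'u v'L].
  have [_ _ _ h] := stepB _ _ _ mt uL uC.
  by have [_ -> _] := h v vL vu; have [_ -> _] := h v' v'L v'u.
have [pu [u [L [mt uL uC]]]] := stepA.
have [qk hX uN hv] := stepB _ _ _ mt uL uC.
have [_ _ cL] := mt.
have cLu : #|L :\ u| = k by move: cL; rewrite (cardsD1 u L) uL qk => -[].
have LX : L :\ u \subset ~: C.
  by apply/subsetP => v; rewrite !inE => /andP[vu vL]; have [] := hv v vL vu.
have [v0 v0L] : exists v, v \in L :\ u by apply/card_gt0P; rewrite cLu; apply: ltnW.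
pose Z := [set w | H v0 w].
have NL v : v \in L :\ u -> [set w | H v w] = Z.
  by move=> vL; apply: same vL v0L => //; exists pu.
(* As k >= 2, there is a second leaf outside [C]; it remains a leaf when [v0] is swapped out. *)
have [v1 v1L v10] : exists2 v, v \in L :\ u & v != v0.
  have /card_gt0P[v] : 0 < #|L :\ u :\ v0|.
    by move: cLu k1; rewrite (cardsD1 v0) v0L; clear; lia.
  by rewrite in_setD1 => /andP[? ?]; exists v.
have [p mt1] := min_tree_reroot v0 mt.
have [v0u v0L'] : v0 != u /\ v0 \in L by move: v0L; rewrite !inE => /andP.
have [v1u v1L'] : v1 != u /\ v1 \in L by move: v1L; rewrite !inE => /andP.
have uv0 : u != v0 by rewrite eq_sym.
have PY : nbr_parents H p v0 \subset ~: C :\: (L :\ u).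
  apply/subsetP => z zP; have zL := nbr_parents_nleaf q3 qmin mt1 v0L' zP.
  have := nbr_parents_nadj q3 qmin mt1 v0L' uL uv0 zP => uz.
  rewrite !inE (negPf zL) andbF /=; apply: contra uz => zC; apply: clC => //.
  by apply: contraNneq zL => <-.
have PYe : nbr_parents H p v0 = ~: C :\: (L :\ u).
  apply/eqP; rewrite eqEcard PY cardsDS // cLu hX.
  have := card_nbr_parents q3 qmin mt1 v0L'; have := dmin v0; clear; lia.
(* A vertex [x] outside [C] that is not yet a leaf becomes one when [v0] is swapped out; the new
   minimal tree gives it the neighbourhood of [v1]. *)
have NX x : x \notin C -> [set w | H x w] = Z.
  move=> xC; have [/NL//|xL] := boolP (x \in L :\ u).
  have : x \in nbr_parents H p v0 by rewrite PYe in_setD xL inE.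
  rewrite in_setD1 => /andP[+ /imsetP[w]]; rewrite inE => xv0 vw e; subst x.
  have [_ _ [p' mt']] := leaf_swap q3 qmin mt1 v0L' vw xv0.
  have uL' : u \in p w |: L :\ v0 by rewrite !inE uv0 uL orbT.
  have wu : p w != u by apply: contraNneq xC => ->.
  rewrite -(NL _ v1L); apply: (same (p w |: L :\ v0) u) => //.
  - exact: min_tree_reroot mt'.
  - by rewrite !inE wu eqxx.
  - by rewrite !inE v1u v10 v1L' orbT.
exists Z; split=> //.
  by have [_ _ dv] := hv v0 v0L' v0u.
apply/subsetP => z zZ; apply: contraT => zC.
by move: (zZ); rewrite -(NX z zC) inE adj_irrefl.
Qed.

End ExtremalStructure.

(** * A large clique from few non-edges *)

Section LargeClique.
Variables (V : finType) (H : sgraph V).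

Definition codegree x := #|[set y | (y != x) && ~~ H x y]|.

Lemma degree_codegree x : degree H x + codegree x + 1 = #|V|.
Proof.
rewrite /degree -(cardsC [set y | H x y]) -addnA; congr (_ + _).
rewrite (cardsD1 x (~: _)) !inE adj_irrefl addnC; congr (_ + _).
by apply: eq_card => y; rewrite !inE.
Qed.

(** Non-edges inside [A] make at most #|A| * (#|A| - 1) ordered pairs; those leaving [A] are counted
    a second time from their outer ends. *)
Lemma codegree_sum (A : {set V}) :
  2 * \sum_(x in A) codegree x <= \sum_x codegree x + #|A| * (#|A| - 1).
Proof.
pose c x y : nat := (y != x) && ~~ H x y.
have cs x y : c x y = c y x by rewrite /c eq_sym adj_sym.
have cE x : codegree x = \sum_(y in A) c x y + \sum_(y | y \notin A) c x y.
  rewrite -[RHS](bigID (mem A) predT (c x)) /= /codegree -sum1dep_card big_mkcond.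
  by apply: eq_bigr => y _; rewrite /c; case: ifP.
rewrite (bigID (mem A) predT codegree) /= mul2n -addnn -addnA leq_add2l.
rewrite (eq_bigr _ (fun x _ => cE x)) big_split /= addnC leq_add //.
  rewrite exchange_big /=; apply: leq_sum => x _; rewrite cE.
  by rewrite (eq_bigr _ (fun y _ => cs y x)) leq_addr.
rewrite -sum_nat_const; apply: leq_sum => x xA.
rewrite (cardsD1 x A) xA addKn -sum1_card [in X in _ <= X]big_mkcond /= big_mkcond /=.
by apply: leq_sum => y _; rewrite !inE /c; case: (_ \in A); case: (y != x) => //; case: (H x y).
Qed.

Lemma subset_of_card (A : {set V}) m : m <= #|A| -> exists2 B : {set V}, B \subset A & #|B| = m.
Proof.
move=> mA; exists [set x in take m (enum A)].
  by apply/subsetP => x; rewrite inE => /mem_take; rewrite mem_enum.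
by rewrite cardsE (card_uniqP _) ?take_uniq ?enum_uniq // size_takel // -cardE.
Qed.

(** Two vertices that are not [low] have degree sum at least n - 1, so such vertices form a clique,
    which is extended to a maximal clique [C]. More than [s] vertices outside [C] would force too
    many non-edges. *)
Lemma large_clique s : 1 < s -> 6 * s + 5 <= #|V| -> 3 * s ^ 2 + 3 * s + 4 <= 2 * #|V| ->
  (forall u v, u != v -> ~~ H u v -> degree H u + degree H v + 2 <= #|V|) ->
  \sum_x codegree x < 2 * s * (#|V| - 1) ->
  exists C : {set V}, {in C &, forall x y, x != y -> H x y} /\ #|~: C| <= s.
Proof.
move=> s1 n6 n3 closed N.
pose low := [set x | 2 * degree H x + 2 <= #|V|].
have lowsmall : #|low| < uphalf #|V|.
  rewrite ltnNge; apply/negP => /subset_of_card[A /subsetP Al cA].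
  have := codegree_sum A.
  have : #|A| * #|V| <= 2 * \sum_(x in A) codegree x.
    rewrite -sum_nat_const big_distrr /=; apply: leq_sum => x /Al; rewrite inE.
    by have := degree_codegree x; clear; move: #|V| => n; lia.
  have s8 : 8 * s <= #|V| + 2.
    have [le|lt] := leqP s 3; first by move: n6 le; clear; lia.
    have [r sE] : exists r, s = 4 + r by exists (s - 4); rewrite subnKC.
    by move: n3; rewrite sE -mulnn mulnDl !mulnDr; clear; lia.
  have := odd_double_half #|V|; move: cA; rewrite uphalf_half.
  move: N s8 s1; clear; move: (\sum_x _) (\sum_(x in A) _) => N S.
  move: #|V| #|A| => n a; move: (n./2) => h.
  case: (odd n) => /= N1 s8 s1 -> hn a1 a2.
    have : (h + 1) * (h + 1) < 4 * s * h by nia.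
    have : 4 * s <= h + 1 by lia.
    by nia.
  have : h * (h + 1) + 2 * s < 4 * s * h by nia.
  have : 4 * s <= h + 1 by lia.
  by nia.
pose good (C : {set V}) := (~: low \subset C) &&
  [forall x in C, forall y in C, (x != y) ==> H x y].
have goodP C : good C -> ~: low \subset C /\ {in C &, forall x y, x != y -> H x y}.
  move=> /andP[a /forall_inP b]; split => // x y xC yC xy.
  by have /forall_inP/(_ y yC) := b x xC; rewrite xy.
have g0 : good (~: low).
  rewrite /good subxx; apply/forall_inP => x; rewrite !inE -ltnNge => xl.
  apply/forall_inP => y; rewrite !inE -ltnNge => yl; apply/implyP => xy.
  by apply: contraT => nH; have := closed x y xy nH; move: xl yl; clear; lia.
have [C gC Cmax] := @arg_maxnP _ (~: low) good (fun C => #|C|) g0.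
have [lC cl] := goodP C gC; exists C; split => //.
rewrite leqNgt; apply/negP => sX.
have cX : #|~: C| <= #|low| by apply: subset_leq_card; rewrite subCset.
(* A vertex outside the maximal clique [C] misses some vertex of [C], whose degree
   is at least #|C| - 1; the degree-sum condition then bounds its own degree. *)
have dX x : x \in ~: C -> #|C| <= codegree x.
  rewrite inE => xC; have [/existsP[u /andP[uC nux]]|no] := boolP [exists u, (u \in C) && ~~ H u x].
    have ux : u != x by apply: contraNneq xC => <-.
    have := closed u x ux nux; have := degree_codegree x.
    have : #|C| <= (degree H u).+1.
      rewrite (cardsD1 u C) uC ltnS; apply/subset_leq_card/subsetP => y.
      by rewrite !inE => /andP[yu yC]; apply: cl => //; rewrite eq_sym.
    by clear; lia.
  have adjx u : u \in C -> H u x.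
    by move: no; rewrite negb_exists => /forallP/(_ u) + uC; rewrite uC negbK.
  have /Cmax : good (x |: C).
    rewrite /good (subset_trans lC) ?subsetUr //=.
    apply/forall_inP => a; rewrite !inE => /orP[/eqP->|aC]; apply/forall_inP => b;
      rewrite !inE => /orP[/eqP->|bC]; apply/implyP => ab.
    - by rewrite eqxx in ab.
    - by rewrite adj_sym adjx.
    - exact: adjx.
    - exact: cl.
  by rewrite /= cardsU1 xC add1n ltnn.
have := codegree_sum (~: C).
have : #|~: C| * #|C| <= \sum_(x in ~: C) codegree x.
  by rewrite -sum_nat_const; apply: leq_sum.
have := cardsC C; have : 2 * #|~: C| < #|V|.
  have := leq_ltn_trans cX lowsmall; rewrite uphalf_half.
  by have := odd_double_half #|V|; clear; lia.
move: N n6 n3 sX s1; clear; move: (\sum_x _) (\sum_(x in ~: C) _) => N S.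
move: #|V| #|~: C| #|C| => n x c N1 n6 n3 sX s1 x2 nc a1 a2.
have {}nc : c = n - x by lia.
(* [y] is the excess of #|~: C| over s + 1, and [K] the slack in an inequality combining 2 #|~: C| <
   n with n >= 6s + 5. The quadratic bound [n3] then contradicts [h2]. *)
have [y xE] : exists y, x = s + 1 + y by exists (x - s - 1); lia.
subst x c; rewrite -mulnn in n3.
have [K hK] : exists K, 2 * n = 6 * s + 5 + 3 * y + K by exists (2 * n - 6 * s - 5 - 3 * y); lia.
have : 2 * ((s + 1 + y) * (n - (s + 1 + y))) < 2 * s * (n - 1) + (s + 1 + y) * (s + 1 + y - 1) by lia.
have [m hm] : exists m, n = s + 1 + y + m by exists (n - (s + 1 + y)); lia.
subst n; rewrite addKn => h1.
have m2 : 2 * m = 4 * s + 3 + y + K by move: hK; clear; lia.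
have h2 : (1 + y) * (2 * m) < (s + y) * (3 * s + 1 + y) by move: h1; clear; lia.
by rewrite m2 in h2; move: h2 n3 hK; clear; lia.
Qed.

End LargeClique.

(** * Recognising the extremal graph *)

Section ExtremalIso.
Variables (V : finType) (H : sgraph V).

Lemma extremal_iso n k t (Z C : {set V}) : #|V| = n -> 0 < k + t -> k + 2 * t <= n ->
  #|Z| = t -> Z \subset C -> #|~: C| = k + t - 1 ->
  {in C &, forall x y, x != y -> H x y} -> (forall x, x \notin C -> [set w | H x w] = Z) ->
  giso H (extremal_graph n k t).
Proof.
move=> hV kt kn hZ ZC hX clC hN.
have hC : #|C :\: Z| = n - k - 2 * t + 1.
  by rewrite cardsDS // hZ; have := cardsC C; rewrite hX hV; move: kt kn; clear; lia.
pose g (u : 'I_t + ('I_(n - k - 2 * t + 1) + 'I_(k + t - 1))) : V :=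
  match u with
  | inl i => enum_val (cast_ord (esym hZ) i)
  | inr (inl i) => enum_val (cast_ord (esym hC) i)
  | inr (inr i) => enum_val (cast_ord (esym hX) i)
  end.
have g1 i : g (inl i) \in Z by apply: enum_valP.
have g2 i : (g (inr (inl i)) \notin Z) && (g (inr (inl i)) \in C).
  by have := enum_valP (cast_ord (esym hC) i); rewrite in_setD.
have g3 i : g (inr (inr i)) \notin C by have := enum_valP (cast_ord (esym hX) i); rewrite in_setC.
have inZC x : x \in Z -> x \in C by apply/subsetP.
have gI : injective g.
  have d12 i j : g (inl i) != g (inr (inl j)).
    by apply: contraTneq (g1 i) => ->; have /andP[] := g2 j.
  have d13 i j : g (inl i) != g (inr (inr j)).
    by apply: contraTneq (inZC _ (g1 i)) => ->; apply: g3.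
  have d23 i j : g (inr (inl i)) != g (inr (inr j)).
    by have /andP[_ +] := g2 i; apply: contraTneq => ->; apply: g3.
  move=> [i|[i|i]] [j|[j|j]] => e.
  - by congr inl; apply: cast_ord_inj (enum_val_inj e).
  - by have := d12 i j; rewrite e eqxx.
  - by have := d13 i j; rewrite e eqxx.
  - by have := d12 j i; rewrite e eqxx.
  - by congr (inr (inl _)); apply: cast_ord_inj (enum_val_inj e).
  - by have := d23 i j; rewrite e eqxx.
  - by have := d13 j i; rewrite e eqxx.
  - by have := d23 j i; rewrite e eqxx.
  - by congr (inr (inr _)); apply: cast_ord_inj (enum_val_inj e).
have HC x y : x \in C -> y \in C -> H x y = (x != y).
  by move=> xC yC; have [->|xy] := eqVneq x y; [rewrite adj_irrefl | rewrite clC].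
have HX x y : x \notin C -> H x y = (y \in Z) by move=> /hN <-; rewrite inE.
have [f gK fK] : bijective g.
  apply: inj_card_bij => //; rewrite !card_sum !card_ord hV.
  by move: kt kn; clear; lia.
have gE u v : extremal_graph n k t u v = H (g u) (g v).
  have g1C i := inZC _ (g1 i); have g2C i : g (inr (inl i)) \in C by have /andP[] := g2 i.
  have g2Z i : g (inr (inl i)) \notin Z by have /andP[] := g2 i.
  case: u v => [i|[i|i]] [j|[j|j]].
  - by rewrite HC // (inj_eq gI).
  - by rewrite HC // (inj_eq gI).
  - by rewrite [RHS]adj_sym [RHS]HX // g1.
  - by rewrite HC // (inj_eq gI).
  - by rewrite HC // (inj_eq gI).
  - by rewrite [RHS]adj_sym HX // (negPf (g2Z i)).
  - by rewrite HX // g1.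
  - by rewrite HX // (negPf (g2Z j)).
  - by rewrite HX //; apply/esym; apply: contraNF (g3 j) => /inZC.
by exists f => [|x y]; [exists g | rewrite gE !fK].
Qed.

End ExtremalIso.

(** * Consequences of t-connectedness and the combinatorial half of the proof *)

Section Connectivity.
Variables (V : finType) (G : sgraph V).

Lemma t_connected_connected t : 0 < t -> t_connected t G -> connected G.
Proof.
move=> t0 [tV hG]; split; first exact: leq_ltn_trans tV.
have [|_ cG] := hG set0; first by rewrite cards0.
have mem x : x \in ~: (set0 : {set V}) by rewrite !inE.
move=> x y; have := cG (exist _ x (mem x)) (exist _ y (mem y)).
move=> /connectP[p pp /(congr1 val) /= ->];
rewrite -[x in connect _ x]/(val (exist (fun x => x \in ~: (set0 : {set V})) x (mem x))).
elim: p (exist _ x (mem x)) pp => [|b p IH] a /=.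
  by move=> _; exact: connect0.
by case/andP => ab /IH; apply: connect_trans; apply: connect1.
Qed.

(** With fewer than t neighbours, [x] would be cut off by deleting them from a further vertex, which
    exists because t < n. *)
Lemma t_connected_degree t x : t_connected t G -> t <= degree G x.
Proof.
move=> [tV hG]; rewrite leqNgt; apply/negP => dx.
have [_ cG] := hG _ dx; have xS : x \in ~: [set y | G x y] by rewrite !inE adj_irrefl.
have [y yS yx] : exists2 y, y \in ~: [set y | G x y] & y != x.
  have /card_gt0P[y] : 0 < #|(~: [set y | G x y]) :\ x|.
    have := cardsC [set y | G x y]; move: dx tV; rewrite (cardsD1 x (~: _)) xS /degree.
    by clear; lia.
  by rewrite in_setD1 => /andP[? ?]; exists y.
have /connectP[[|b p] /=] := cG (exist _ x xS) (exist _ y yS).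
  by move=> _ /(congr1 val) /= e; rewrite e eqxx in yx.
by case/andP => xb _ _; have := valP b; rewrite !inE; move/negP; apply.
Qed.

Lemma codegree_leq (H : sgraph V) : subrel G H ->
  \sum_x codegree H x <= \sum_x codegree G x.
Proof.
move=> GH; apply: leq_sum => x _; apply/subset_leq_card/subsetP => y.
by rewrite !inE => /andP[-> /=]; apply: contra => /GH.
Qed.

(** The codegree hypothesis says that there are fewer than (k + t - 1)(n - 1) non-edges. It passes
    to the closure, as do connectedness and the minimum degree. *)
Lemma extremal_supergraph k t : 1 < k -> 0 < t -> t_connected t G -> ~ spans G k ->
  6 * (k + t) <= #|V| + 1 -> 3 * (k + t - 1) ^ 2 + 3 * (k + t) + 1 <= 2 * #|V| ->
  \sum_x codegree G x < 2 * (k + t - 1) * (#|V| - 1) ->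
  exists2 H : sgraph V, subrel G H & giso H (extremal_graph #|V| k t).
Proof.
move=> k1 t0 tG hn n6 n3 hc.
have [H [GH hH closed]] := closed_supergraph hn.
exists H => //.
have [C [clC cX]] : exists C : {set V},
    {in C &, forall x y, x != y -> H x y} /\ #|~: C| <= k + t - 1.
  apply: large_clique => //.
  - by move: k1 t0; clear; lia.
  - by move: n6 k1 t0; clear; move: #|V| => n; lia.
  - by move: n3 k1 t0; clear; move: #|V| (_ ^ 2) => n m; lia.
  - exact: leq_ltn_trans (codegree_leq GH) hc.
have cH : connected H.
  have [V0 cG] := t_connected_connected t0 tG; split=> // x y.
  by apply: connect_sub (cG x y) => a b /GH; apply: connect1.
have dH x : t <= degree H x.
  apply: leq_trans (t_connected_degree x tG) _.
  by apply/subset_leq_card/subsetP => y; rewrite !inE; apply: GH.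
have [Z [cZ ZC hX hN]] := extremal_structure k1 t0 cH clC dH hH cX.
apply: (extremal_iso erefl _ _ cZ ZC hX clC hN); first by rewrite addn_gt0 t0 orbT.
by move: n6 k1 t0; clear; move: #|V| => n; lia.
Qed.

End Connectivity.

From mathcomp Require Import boolp classical_sets reals.
From mathcomp Require Import ring lra.
Import Order.TTheory.

(** * Eigenvectors of the signless Laplacian as functions on vertices *)

Section Spectrum.
Local Open Scope ring_scope.
Variable R : realType.

Section Eigenfunctions.
Variables (V : finType) (G : sgraph V).

(** This is Qy = ay read at each vertex: the diagonal entry of Q contributes [y v] once per
    neighbour of [v]. *)
Definition eigenfun (a : R) (y : V -> R) :=
  forall v, \sum_(w | G v w) (y v + y w) = a * y v.

Lemma mulmx_signless (u : 'rV[R]_#|V|) x :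
  (u *m signless_laplacian R G) 0 (enum_rank x) =
  \sum_(w | G x w) (u 0 (enum_rank x) + u 0 (enum_rank w)).
Proof.
rewrite mxE (reindex enum_rank) /=; last exact/onW_bij/enum_rank_bij.
under eq_bigr => w _ do rewrite !mxE !enum_rankK (inj_eq enum_rank_inj) mulrDr.
rewrite big_split [in RHS]big_split /=; congr (_ + _).
  rewrite (bigD1 x) //= eqxx mulr1n big1 => [|w /negPf->]; last by rewrite mulr0n mulr0.
  by rewrite addr0 sumr_const mulr_natr /degree cardsE.
rewrite [RHS]big_mkcond; apply: eq_bigr => w _; rewrite adj_sym.
by case: (G x w); rewrite ?mulr1 ?mulr0.
Qed.

Lemma eigenvalue_eigenfun a : eigenvalue (signless_laplacian R G) a ->
  exists2 y, eigenfun a y & exists v, y v != 0.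
Proof.
move=> /eigenvalueP[u ua u0]; exists (fun w => u 0 (enum_rank w)).
  by move=> v; rewrite -mulmx_signless ua mxE.
have [j] : exists j, u 0 j != 0.
  apply/existsP; apply: contraNT u0; rewrite negb_exists => /forallP h.
  by apply/eqP/rowP => j; rewrite mxE; apply/eqP; have := h j; rewrite negbK.
by exists (enum_val j); rewrite enum_valK.
Qed.

Lemma eigenfun_eigenvalue a y v : eigenfun a y -> y v != 0 ->
  eigenvalue (signless_laplacian R G) a.
Proof.
move=> ya yv; apply/eigenvalueP; exists (\row_j y (enum_val j)).
  apply/rowP => j; rewrite -[j]enum_valK mulmx_signless !mxE enum_rankK -ya.
  by apply: eq_bigr => w _; rewrite !mxE enum_rankK.
by apply: contra yv => /eqP/rowP/(_ (enum_rank v)); rewrite !mxE enum_rankK => ->.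
Qed.

(** The eigenvalue is at most d + S/d for some vertex of degree d whose neighbours have degree sum
    S, and d + S/d <= 2e/(n - 1) + n - 2. *)
Lemma eigenfun_degree_bound a y v0 : (forall x, (0 < degree G x)%N) ->
  eigenfun a y -> y v0 != 0 ->
  a * (#|V|%:R - 1) <= (\sum_x degree G x)%:R + (#|V|%:R - 2) * (#|V|%:R - 1).
Proof.
move=> d0 ya y0; pose d x : R := (degree G x)%:R.
have dp x : 0 < d x by rewrite ltr0n.
have [x _ xmax] := @arg_maxP _ R _ v0 predT (fun x => `|y x| / d x) isT.
set M := `|y x| / d x in xmax.
have My w : `|y w| <= M * d w by rewrite -ler_pdivrMr //; apply: xmax.
have M0 : 0 < M.
  by apply: lt_le_trans (xmax v0 isT); rewrite divr_gt0 // normr_gt0.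
have yx : `|y x| = M * d x by rewrite /M divfK // gt_eqF.
pose S : R := \sum_(w | G x w) d w.
(* Maximality of |y|/d at [x]: this is the row-sum bound for D^-1 Q D. *)
have aS : a * d x <= d x * d x + S.
  have : a * `|y x| <= d x * `|y x| + M * S.
    apply: le_trans (_ : `|a| * `|y x| <= _); first by rewrite ler_wpM2r // ler_norm.
    rewrite -normrM -ya big_split /= sumr_const; apply: le_trans (ler_normD _ _) _.
    apply: lerD; first by rewrite normrMn -mulr_natl /d /degree cardsE.
    apply: le_trans (ler_norm_sum _ _ _) _; rewrite mulr_sumr; apply: ler_sum => w _; exact: My.
  rewrite yx => h; rewrite -(ler_pM2l M0); move: h; rewrite mulrDr; nra.
have n1 : (degree G x < #|V|)%N by have := degree_codegree G x; move: #|V| => n; lia.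
have [SN SE] : exists SN : nat, S = SN%:R by exists (\sum_(w | G x w) degree G w)%N; rewrite natr_sum.
have SNE : SN = (\sum_(w | G x w) degree G w)%N.
  by apply/eqP; rewrite -(eqr_nat R) -SE natr_sum.
have b1 : (SN <= degree G x * (#|V| - 1))%N.
  rewrite SNE {2}/degree -cardsE -sum_nat_const big_mkcond [X in (_ <= X)%N]big_mkcond.
  apply: leq_sum => w _; rewrite !inE; case: (G x w) => //.
  by have := degree_codegree G w; move: #|V| => n; lia.
(* Outside the neighbourhood of [x] there are [x] itself and [codegree G x] vertices of degree at
   least 1; their degrees sum to at least n - 1. *)
have b2 : (SN + (#|V| - 1) <= \sum_x degree G x)%N.
  rewrite (bigID (G x) predT) /= SNE leq_add2l.
  have nx : ~~ G x x by rewrite adj_irrefl.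
  rewrite (bigD1 x) //= -(degree_codegree G x) addnK leq_add2l /codegree -sum1dep_card.
  rewrite (eq_bigl (fun w => ~~ G x w && (w != x))); last by move=> w; rewrite andbC.
  by apply: leq_sum => w _; apply: d0.
have nR : #|V|%:R - 1 = (#|V| - 1)%:R :> R by rewrite natrB // (leq_ltn_trans _ n1).
have {}b1 : S <= d x * (#|V|%:R - 1).
  by rewrite SE nR -natrM ler_nat.
have {}b2 : S + (#|V|%:R - 1) <= (\sum_x degree G x)%:R.
  by rewrite SE nR -natrD ler_nat.
have n1' : d x + 1 <= #|V|%:R by rewrite /d natr1 ler_nat.
rewrite -(ler_pM2l (dp x)); move: n1' b1 b2 aS (dp x).
move: (_%:R) #|V|%:R (d x) (S) => D n dx T h1 h2 h3 h4 h5.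
(* This product is the exact difference of the two sides once [a] and [D] are replaced by their
   bounds. *)
have : 0 <= (n - 1 - dx) * (dx * (n - 1) - T) by apply: mulr_ge0; lra.
have : dx * (T + (n - 1)) <= dx * D by rewrite ler_pM2l.
have : a * dx * (n - 1) <= (dx * dx + T) * (n - 1) by rewrite ler_wpM2r //; lra.
nra.
Qed.

End Eigenfunctions.

(** [E] and [D] are the nonnegative defects in a|y| <= Q(G)|y| and Q(G)x <= qx. The positive
    eigenvector [x] takes the place of Perron-Frobenius theory. *)
Lemma eigenfun_compare (V : finType) (G K : sgraph V) q a x y v0 :
  subrel G K -> (forall v, 0 < x v) -> eigenfun K q x -> eigenfun G a y -> y v0 != 0 ->
  a <= q /\ (connected G -> (exists v w, K v w && ~~ G v w) -> a < q).
Proof.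
move=> GK xp xq ya y0; pose z v := `|y v|.
have z0 v : 0 <= z v by apply: normr_ge0.
pose E v := \sum_(w | G v w) (z v + z w) - a * z v.
pose D v := \sum_(w | K v w && ~~ G v w) (x v + x w).
have E0 v : 0 <= E v.
  rewrite subr_ge0; apply: le_trans (_ : `|a| * z v <= _); first by rewrite ler_wpM2r // ler_norm.
  rewrite -normrM -ya; apply: le_trans (ler_norm_sum _ _ _) _.
  by apply: ler_sum => w _; apply: ler_normD.
have D0 v : 0 <= D v by apply: sumr_ge0 => w _; apply/ltW/addr_gt0.
have DE v : \sum_(w | G v w) (x v + x w) = q * x v - D v.
  rewrite -xq [X in _ = X - _](bigID (G v)) /= -/(D v) addrK; apply: eq_bigl => w.
  by case: (boolP (G v w)) => [/GK->|]; rewrite ?andbF.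
(* Pair the eigenvector equation of G with [x] and use the symmetry of Q(G). *)
have id : (q - a) * \sum_v x v * z v = \sum_v (x v * E v + z v * D v).
  have sym : \sum_v x v * (\sum_(w | G v w) (z v + z w)) =
             \sum_v z v * (\sum_(w | G v w) (x v + x w)).
    under eq_bigr => v _ do rewrite big_split mulrDr /=.
    under [RHS]eq_bigr => v _ do rewrite big_split mulrDr /=.
    rewrite !big_split /=; congr (_ + _).
      by apply: eq_bigr => v _; rewrite !sumr_const !mulrnAr mulrC.
    under eq_bigr => v _ do rewrite mulr_sumr.
    under [RHS]eq_bigr => v _ do rewrite mulr_sumr.
    rewrite (exchange_big_dep predT) //=; apply: eq_bigr => v _.
    by apply: eq_big => [w|w _]; rewrite 1?adj_sym // mulrC.
  rewrite mulr_sumr; apply/eqP; rewrite -subr_eq0 -sumrB; apply/eqP.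
  transitivity (\sum_v (z v * (\sum_(w | G v w) (x v + x w)) -
                        x v * (\sum_(w | G v w) (z v + z w)))).
    by apply: eq_bigr => v _; rewrite DE /E; ring.
  by rewrite sumrB sym subrr.
have pos : 0 < \sum_v x v * z v.
  rewrite (bigD1 v0) //=; apply: ltr_pwDl; first by rewrite mulr_gt0 // normr_gt0.
  by apply: sumr_ge0 => v _; rewrite mulr_ge0 // ltW.
have t0 v : 0 <= x v * E v + z v * D v by rewrite addr_ge0 // mulr_ge0 // ltW.
have aq : a <= q.
  by rewrite -subr_ge0 -(pmulr_lge0 _ pos) id; apply: sumr_ge0.
split=> // -[_ cG] [v [w /andP[Kvw nG]]]; rewrite lt_neqAle aq andbT; apply/eqP => e.
have all0 u : x u * E u + z u * D u = 0.
  have s0 : \sum_u (x u * E u + z u * D u) = 0 by rewrite -id e subrr mul0r.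
  exact: (psumr_eq0P (fun i _ => t0 i) s0).
have E_0 u : E u = 0.
  have xE : x u * E u = 0.
    apply/eqP; rewrite eq_le mulr_ge0 ?(ltW (xp u)) // andbT -(all0 u) lerDl.
    exact: mulr_ge0.
  by move/eqP: xE; rewrite mulf_eq0 gt_eqF //= => /eqP.
(* The missing edge makes [D v] positive, so |y| vanishes at [v]; as [E] is zero, the zero set of
   |y| is closed under adjacency in [G]. *)
have zv : z v = 0.
  have : z v * D v = 0 by have := all0 v; rewrite E_0 mulr0 add0r.
  move/eqP; rewrite mulf_eq0 => /orP[/eqP//|/eqP Dv].
  have : 0 < D v.
    rewrite /D (bigD1 w) ?Kvw //=; apply: ltr_pwDl; first exact: addr_gt0.
    by apply: sumr_ge0 => u _; apply/ltW/addr_gt0.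
  by rewrite Dv ltxx.
have cl : closed G [pred u | z u == 0].
  apply: (intro_closed (sym_connect_sym (@adj_sym _ G))) => b c bc /eqP /= zb.
  have := E_0 b; rewrite /E zb mulr0 subr0; under eq_bigr => u _ do rewrite add0r.
  by move=> h; rewrite inE; apply/eqP; apply: (psumr_eq0P _ h) => // u _.
have := closed_connect cl (cG v v0); rewrite !inE zv eqxx => /esym.
by rewrite normr_eq0 (negPf y0).
Qed.

End Spectrum.

(** * The radius as an attained maximum, and the extremal eigenvector *)

Section Radius.
Local Open Scope ring_scope.
Variable R : realType.

Lemma finite_roots (p : {poly R}) : p != 0 -> exists s : seq R, forall a, root p a -> a \in s.
Proof.
have [n] := ubnP (size p); elim: n p => // n IH p lp p0.
have [[a pa]|no] := pselect (exists a, root p a); last first.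
  by exists [::] => a pa; case: no; exists a.
have [r pr] := factor_theorem _ _ pa; subst p.
have r0 : r != 0 by apply: contraNneq p0 => ->; rewrite mul0r.
have [|s hs] := IH r _ r0.
  by move: lp; rewrite size_Mmonic ?monicXsubC // size_XsubC addn2 /=.
exists (a :: s) => b; rewrite rootM root_XsubC inE => /orP[/hs->|->//].
by rewrite orbT.
Qed.

Lemma seq_max (s : seq R) a : a \in s -> exists2 m, m \in s & forall b, b \in s -> b <= m.
Proof.
elim: s a => // c [|d s] IH a as_; first by exists c => [|b]; rewrite !inE // => /eqP->.
have [m ms mb] := IH d (mem_head _ _); have [cm|mc] := leP c m.
  exists m; first by rewrite inE ms orbT.
  by move=> b; rewrite inE => /orP[/eqP->|/mb].
exists c; first exact: mem_head.
by move=> b; rewrite inE => /orP[/eqP->//|/mb/le_trans]; apply; apply: ltW.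
Qed.

Lemma signless_radius_max (V : finType) (G : sgraph V) a :
  eigenvalue (signless_laplacian R G) a ->
  eigenvalue (signless_laplacian R G) (signless_radius R G) /\ a <= signless_radius R G.
Proof.
move=> ea; set Q := signless_laplacian R G in ea *.
have [s hs] := finite_roots (monic_neq0 (char_poly_monic Q)).
have inE' b : eigenvalue Q b = (b \in [seq b <- s | eigenvalue Q b]).
  rewrite mem_filter; case: (boolP (eigenvalue Q b)) => //= eb.
  by rewrite hs // -eigenvalue_root_char.
have [m ms mb] := seq_max (etrans (esym (inE' a)) ea).
have em : eigenvalue Q m by rewrite inE'.
have ub : ubound [set b | eigenvalue Q b]%classic m by move=> b /=; rewrite inE' => /mb.
have -> : signless_radius R G = m.
  apply/eqP; rewrite eq_le ge_sup //=; last by exists a.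
  by apply: ub_le_sup => //; exists m.
by split=> //; apply: ub.
Qed.

(** The supremum of the empty set is 0 by convention, so a nonzero radius already shows that an
    eigenvalue exists. *)
Lemma signless_radius_eigenvalue (V : finType) (G : sgraph V) :
  signless_radius R G != 0 -> eigenvalue (signless_laplacian R G) (signless_radius R G).
Proof.
move=> r0; have [[a ea]|no] := pselect (exists a, eigenvalue (signless_laplacian R G) a).
  by have [] := signless_radius_max ea.
case/eqP: r0; rewrite /signless_radius (_ : [set a | _]%classic = set0) ?sup0 //.
by apply/seteqP; split=> // a ea; apply: no; exists a.
Qed.

(* For [c], [s], [t] the sizes of the three cells, this cubic is the condition for
   [q] to be an eigenvalue with an eigenvector constant on cells. *)
Lemma extremal_poly_root (c s t : R) : 1 <= c -> 1 <= s -> 1 <= t ->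
  exists2 q, 2 * (c + t - 1) < q &
    (q - (c + s + t) - t + 2) * (q - t) * (q - t - 2 * c + 2)
      = t * c * (q - t) + t * s * (q - t - 2 * c + 2).
Proof.
move=> c1 s1 t1.
pose P : {poly R} := ('X - (c + s + t + t - 2)%:P) * ('X - t%:P) * ('X - (t + 2 * c - 2)%:P)
  - ((t * c)%:P * ('X - t%:P) + (t * s)%:P * ('X - (t + 2 * c - 2)%:P)).
have PE x : P.[x] = (x - (c + s + t) - t + 2) * (x - t) * (x - t - 2 * c + 2)
    - (t * c * (x - t) + t * s * (x - t - 2 * c + 2)).
  by rewrite /P !(hornerD, hornerN, hornerM, hornerX, hornerC); ring.
(* 2(c + t - 1) is the radius of the clique on the c + t vertices of the first and third sizes. *)
have Pa : P.[2 * (c + t - 1)] < 0.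
  have -> : P.[2 * (c + t - 1)] = - (t * s * (2 * c + 2 * t - 2)) by rewrite PE; ring.
  by rewrite oppr_lt0; apply: mulr_gt0; [apply: mulr_gt0; lra | lra].
pose b := t + 2 * c - 2 + 2 * (c + s + t).
have Pb : 0 <= P.[b].
  have -> : P.[b] = (4 * c + 2 * s + 2 * t - 2) * ((3 * c + s + t) * (2 * (c + s + t)) - t * c)
     - t * s * (2 * (c + s + t)) by rewrite PE /b; ring.
  have ts : 0 <= t * s by apply: mulr_ge0; lra.
  have h : t * s <= (3 * c + s + t) * (2 * (c + s + t)) - t * c.
    have : 0 <= t * c by apply: mulr_ge0; lra.
    have : 0 <= c * c by apply: mulr_ge0; lra.
    have : 0 <= s * c by apply: mulr_ge0; lra.
    have : 0 <= s * s by apply: mulr_ge0; lra.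
    have : 0 <= t * t by apply: mulr_ge0; lra.
    nra.
  apply: le_trans (_ : (4 * c + 2 * s + 2 * t - 2) * (t * s) - t * s * (2 * (c + s + t)) <= _).
    have -> : (4 * c + 2 * s + 2 * t - 2) * (t * s) - t * s * (2 * (c + s + t)) =
      (t * s) * (2 * (c - 1)) by ring.
    by apply: mulr_ge0 => //; lra.
  by rewrite lerD2r ler_pM2l //; lra.
have [||q /andP[aq _] /rootP Pq] := @poly_ivt R P (2 * (c + t - 1)) b.
- by rewrite /b; lra.
- by rewrite (ltW Pa) Pb.
exists q; last by apply/eqP; rewrite -subr_eq0 -PE Pq.
by rewrite lt_neqAle aq andbT; apply/eqP => e; move: Pa; rewrite e Pq ltxx.
Qed.

Lemma sum_join3 (A B C : finType) (P : pred (A + (B + C))) (F : A + (B + C) -> R) :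
  \sum_(w | P w) F w = \sum_(i | P (inl i)) F (inl i)
    + (\sum_(i | P (inr (inl i))) F (inr (inl i)) + \sum_(i | P (inr (inr i))) F (inr (inr i))).
Proof. by rewrite big_sumType; congr (_ + _); rewrite big_sumType. Qed.

Lemma extremal_eigenfun n k t : (0 < t)%N -> (1 < k + t)%N -> (k + 2 * t <= n)%N ->
  exists q (x : 'I_t + ('I_(n - k - 2 * t + 1) + 'I_(k + t - 1)) -> R),
    [/\ 2 * (n%:R - k%:R - t%:R) < q, forall v, 0 < x v & eigenfun (extremal_graph n k t) q x].
Proof.
move=> t1 kt nk; rewrite /extremal_graph.
have cE : (n - k - 2 * t + 1)%:R = n%:R - k%:R - 2 * t%:R + 1 :> R.
  by rewrite natrD -subnDA natrB // natrD natrM; ring.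
have sE : (k + t - 1)%:R = k%:R + t%:R - 1 :> R by rewrite natrB ?natrD // ltnW.
have c1 : (0 < n - k - 2 * t + 1)%N by rewrite addn1.
have s1 : (0 < k + t - 1)%N by rewrite subn_gt0.
move: c1 s1 cE sE; move: (n - k - 2 * t + 1)%N (k + t - 1)%N => cN sN c1 s1 cE sE.
have [|||q qb qE] := @extremal_poly_root cN%:R sN%:R t%:R; rewrite ?ler1n //.
have tp : 1 <= t%:R :> R by rewrite ler1n.
have cp : 1 <= cN%:R :> R by rewrite ler1n.
(* [A] solves the equation q = t(1 + A) at a vertex of the edgeless part, where the value is 1, and
   [B] the equation on the clique of size [cN]. The remaining equation is the cubic, divided by [dd]
   in [hA]. *)
pose A := (q - t%:R) / t%:R; pose B := (q - t%:R) / (q - t%:R - 2 * cN%:R + 2).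
have d1 : 0 < q - t%:R by lra.
have d2 : 0 < q - t%:R - 2 * cN%:R + 2 by lra.
have tA : t%:R * A = q - t%:R by rewrite mulrC divfK // gt_eqF //; lra.
have dB : (q - t%:R - 2 * cN%:R + 2) * B = q - t%:R by rewrite mulrC divfK // gt_eqF.
have hA : (q - (cN%:R + sN%:R + t%:R) - t%:R + 2) * A = cN%:R * B + sN%:R.
  have dd : t%:R * (q - t%:R - 2 * cN%:R + 2) != 0 by rewrite mulf_neq0 // gt_eqF //; lra.
  apply: (mulfI dd); move: qE tA dB.
  move: (q - _ - _ + 2) (q - t%:R - 2 * cN%:R + 2) => u d qE tA dB.
  transitivity (u * d * (t%:R * A)); first by ring.
  rewrite tA; transitivity (t%:R * cN%:R * (d * B) + t%:R * sN%:R * d); last by ring.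
  by rewrite dB -qE; ring.
exists q, (fun v => match v with inl _ => A | inr (inl _) => B | inr (inr _) => 1 end).
split.
- by apply: le_lt_trans qb; rewrite cE; lra.
- by case=> [_|[_|_]] //; [apply: divr_gt0 => //; lra | apply: divr_gt0].
have cI m (i : 'I_m) : (#|[pred j | i != j]|)%:R = m%:R - 1 :> R.
  have := cardC1 i; rewrite card_ord => e.
  have m0 : (0 < m)%N by apply: leq_ltn_trans (ltn_ord i).
  rewrite -subn1 in e; have -> : m%:R - 1 = (m - 1)%:R :> R by rewrite natrB.
  rewrite -e; congr (_%:R).
  by apply: eq_card => j; rewrite !inE eq_sym.
case=> [i|[i|i]].
- transitivity (\sum_(j | i != j) (A + A)
      + (\sum_(j : 'I_cN) (A + B) + \sum_(j : 'I_sN) (A + 1))); first by rewrite sum_join3.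
  rewrite !sumr_const !card_ord -(mulr_natr (A + A)) -(mulr_natr (A + B)) -(mulr_natr (A + 1)) cI.
  move: hA; move: (B) => B' hA.
  by rewrite -[RHS]addr0 -(subrr (cN%:R * B' + sN%:R)) -{2}hA; ring.
- transitivity (\sum_(j : 'I_t) (B + A)
      + (\sum_(j | i != j) (B + B) + \sum_(j < sN | false) (B + 1))); first by rewrite sum_join3.
  rewrite big_pred0_eq !sumr_const card_ord -(mulr_natr (B + A)) -(mulr_natr (B + B)) cI.
  move: tA dB; move: (A) (B) => A' B' tA dB.
  move: tA dB; clear; move: (t%:R) (cN%:R) => t' c' tA dB; nra.
- transitivity (\sum_(j : 'I_t) (1 + A)
      + (\sum_(j < cN | false) (1 + B) + \sum_(j < sN | false) (1 + 1))); first by rewrite sum_join3.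
  rewrite !big_pred0_eq sumr_const card_ord -(mulr_natr (1 + A)) !addr0 mulr1 mulrDl mul1r (mulrC A) tA.
  by rewrite addrC subrK.
Qed.
End Radius.

(** * From the spectral hypothesis to the extremal graph *)

Local Open Scope ring_scope.

(** Degrees and codegrees add up to n(n - 1), so the lower bound on edges from
    [eigenfun_degree_bound] becomes an upper bound on non-edges. *)
Lemma codegree_sum_bound (R : realType) (V : finType) (G : sgraph V) (a : R) m :
  (0 < m < #|V|)%N -> (forall x, (0 < degree G x)%N) ->
  eigenvalue (signless_laplacian R G) a -> 2 * (#|V|%:R - m%:R - 1) < a ->
  (\sum_x codegree G x < 2 * m * (#|V| - 1))%N.
Proof.
move=> /andP[m0 mV] d0 ea am; have [y ya [v yv]] := eigenvalue_eigenfun ea.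
have := eigenfun_degree_bound d0 ya yv.
have S : (\sum_x codegree G x + \sum_x degree G x = #|V| * (#|V| - 1))%N.
  rewrite -big_split -sum_nat_const; apply: eq_bigr => x _ /=.
  by rewrite -(degree_codegree G x) addnK addnC.
have nR : (#|V| - 1)%:R = #|V|%:R - 1 :> R by rewrite natrB // (leq_trans _ mV).
have m1 : 1 + m%:R <= #|V|%:R :> R by rewrite nat1r ler_nat.
have mp : 1 <= m%:R :> R by rewrite ler1n.
rewrite -(ltr_nat R) !natrM nR.
have := congr1 (fun i => i%:R : R) S; rewrite natrD natrM nR => h1 h2.
have p1 : 0 < #|V|%:R - 1 :> R by lra.
have h3 : 2 * (#|V|%:R - m%:R - 1) * (#|V|%:R - 1) < a * (#|V|%:R - 1) by rewrite ltr_pM2r.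
move: h1 h2 h3; clear; move: (#|V|%:R) (m%:R) => N m'.
by move: ((\sum_x codegree G x)%N%:R) ((\sum_x degree G x)%N%:R) => c d h1 h2 h3; nra.
Qed.

Unset Implicit Arguments.

Theorem theorem4p3 (R : realType) (k t n : nat) (V : finType) (G : sgraph V)
  (hk : (2 <= k)%N) (ht : (1 <= t)%N)
  (hn : Num.max (6 * k%:R + 6 * t%:R - 1)
          (3 / 2 * (k%:R + t%:R - 1) ^+ 2 + 3 / 2 * k%:R + 3 / 2 * t%:R + 1 / 2)
        <= n%:R :> R)
  (hV : #|V| = n)
  (hG : t_connected t G)
  (hq : signless_radius R (extremal_graph n k t) <= signless_radius R G) :
  ~ giso G (extremal_graph n k t) -> has_spanning_ended_tree k G.
Proof.
move=> niso; apply: contrapT => ntree; apply: niso.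
have nspan : ~ spans G k by move/spans_ended_tree.
have sE : (k + t - 1)%:R = k%:R + t%:R - 1 :> R by rewrite natrB ?natrD // addn_gt0 ht orbT.
have [n6 n3] : (6 * (k + t) <= n + 1)%N /\ (3 * (k + t - 1) ^ 2 + 3 * (k + t) + 1 <= 2 * n)%N.
  move: hn; rewrite ge_max => /andP[h1 h2].
  by split; rewrite -(ler_nat R) !(natrM, natrD, natrX) ?sE; lra.
have kn : (k + 2 * t <= n)%N by move: n6 hk ht; clear; lia.
have [q [x [qb xp xq]]] := extremal_eigenfun R ht (leq_trans hk (leq_addr t k)) kn.
have [_ qr] := signless_radius_max (eigenfun_eigenvalue xq (lt0r_neq0 (xp (inl (Ordinal ht))))).
have qG := le_trans qr hq.
(* Positivity makes the radius of [G] nonzero, hence an eigenvalue and not the default value of an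
   empty supremum. *)
have q0 : 0 < q.
  apply: le_lt_trans qb; rewrite mulr_ge0 // -addrA -opprD subr_ge0 -natrD ler_nat.
  by move: kn; clear; lia.
have eG := signless_radius_eigenvalue (lt0r_neq0 (lt_le_trans q0 qG)).
have dG y : (0 < degree G y)%N by apply: leq_trans (t_connected_degree y hG).
have hc : (\sum_y codegree G y < 2 * (k + t - 1) * (#|V| - 1))%N.
  apply: (codegree_sum_bound _ dG eG); rewrite hV.
    by move: n6 hk ht; clear; lia.
  by apply: lt_le_trans qG; rewrite sE; lra.
rewrite -hV in n6 n3.
have [H GH isoH] := extremal_supergraph hk ht hG nspan n6 n3 hc.
rewrite hV in isoH; have [f fb fH] := isoH.
have [y ya [v yv]] := eigenvalue_eigenfun eG.
have fx : eigenfun H q (x \o f).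
  move=> u /=; rewrite -xq [RHS](reindex f) /=; last exact: onW_bij.
  by apply: eq_bigl => w; rewrite -fH.
(* An edge of [H] missing from [G] would put the radius of [G] strictly below [q], which [qG]
   excludes. *)
have [_ strict] := eigenfun_compare GH (fun v => xp (f v)) fx ya yv.
exists f => // u w; rewrite fH; apply/idP/idP => [Huw|/GH//].
apply: contraT => nG; have := strict (t_connected_connected ht hG).
by rewrite ltNge qG => /(_ (ex_intro _ u (ex_intro _ w _))); rewrite Huw nG => /(_ isT).
Qed.
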